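(* There exists a constant $C$ such that if $G$ is a graph of Euler genus $g\ge 0$ satisfying $\chi_2(G)=k$, then \[\chi_o(G)<C(k\log k+g+1).\]
   Context: Graphs are finite and simple. An oriented graph is a directed graph with no loops, multiple arcs or pairs of opposite arcs; an orientation of $G$ directs each edge. For an oriented graph $\vec G$: an oriented coloring is a proper vertex coloring $\phi$ such that for any two arcs $uv$, $v'u'$, $(\phi(u),\phi(v))\ne(\phi(u'),\phi(v'))$, with $\chi_o(\vec G)$ its minimum number of colors; a $2$-dipath coloring is a vertex coloring in which any two vertices joined by a directed path of length $1$ or $2$ get different colors, with $\chi_2(\vec G)$ its minimum number of colors. For undirected $G$, $\chi_o(G)$ and $\chi_2(G)$ are the maxima over all orientations of $G$. The Euler genus of a graph is the minimum of $2-\chi(S)$ ($\chi(S)$ the Euler characteristic) over surfaces $S$ into which it embeds. $\log$ is the natural logarithm. *)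

(* Defs.v *)
From HB Require Import structures.
From mathcomp Require Import all_boot all_order all_algebra.
From mathcomp Require Import all_classical all_reals all_analysis.
Set Implicit Arguments.
Unset Strict Implicit.
Unset Printing Implicit Defensive.
Import Order.TTheory GRing.Theory Num.Theory.
Import numFieldNormedType.Exports.
Local Open Scope classical_set_scope.
Local Open Scope ring_scope.

(* A finite simple graph is a symmetric irreflexive [e : rel V] on a finType;
   a digraph on V is its set of arcs [D : {set V * V}]. *)

Definition oriented (V : finType) (D : {set V * V}) : bool :=
  [forall u : V, forall v : V, ((u, v) \in D) ==> ((v, u) \notin D)].

Definition orientation (V : finType) (e : rel V) (D : {set V * V}) : bool :=
  oriented D &&
  [forall u : V, forall v : V, e u v == ((u, v) \in D) || ((v, u) \in D)].

Definition oriented_coloring (V C : finType) (D : {set V * V})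
    (phi : {ffun V -> C}) : bool :=
  [forall u : V, forall v : V, ((u, v) \in D) ==> (phi u != phi v)] &&
  [forall u : V, forall v : V, forall u' : V, forall v' : V,
     ((u, v) \in D) && ((v', u') \in D) ==>
     ((phi u, phi v) != (phi u', phi v'))].

Definition dipath2_coloring (V C : finType) (D : {set V * V})
    (phi : {ffun V -> C}) : bool :=
  [forall u : V, forall v : V, ((u, v) \in D) ==> (phi u != phi v)] &&
  [forall u : V, forall v : V, forall w : V,
     ((u, v) \in D) && ((v, w) \in D) ==> (phi u != phi w)].

Definition oriented_colorable (V : finType) (D : {set V * V}) (k : nat) :=
  [exists phi : {ffun V -> 'I_k}, oriented_coloring D phi].

Definition dipath2_colorable (V : finType) (D : {set V * V}) (k : nat) :=
  [exists phi : {ffun V -> 'I_k}, dipath2_coloring D phi].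

(* The minimum is searched among 0, ..., #|V|: an oriented graph always has
   a coloring with #|V| colors (see the two lemmas below). *)
Definition chi_o_digraph (V : finType) (D : {set V * V}) : nat :=
  [arg min_(k < (ord_max : 'I_(#|V|.+1)) | oriented_colorable D k) k].

Definition chi_2_digraph (V : finType) (D : {set V * V}) : nat :=
  [arg min_(k < (ord_max : 'I_(#|V|.+1)) | dipath2_colorable D k) k].

Lemma chi_o_digraphP (V : finType) (D : {set V * V}) : oriented D ->
  oriented_colorable D (chi_o_digraph D) /\
  (forall k, oriented_colorable D k -> (chi_o_digraph D <= k)%N).
Proof.
move=> /forallP Dor; rewrite /chi_o_digraph; case: arg_minnP => [|i Di imin].
  apply/existsP; exists [ffun v => enum_rank v]; apply/andP; split.
    apply/forallP => u; apply/forallP => v; apply/implyP => uv.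
    rewrite !ffunE (inj_eq enum_rank_inj); apply: contraL uv => /eqP ->.
    by apply/negP => vv; have /forallP/(_ v) := Dor v; rewrite vv.
  do 4![apply/forallP => ?]; apply/implyP => /andP[uv vu].
  rewrite !ffunE xpair_eqE !(inj_eq enum_rank_inj).
  apply: contraL vu => /andP[/eqP <- /eqP <-].
  by move: uv; apply/implyP; exact: (forallP (Dor _)).
split=> // k Dk; case: (ltnP k #|V|.+1) => [kV|/ltnW Vk].
  exact: (imin (Ordinal kV)).
by apply: leq_trans Vk; exact: (ltn_ord i).
Qed.

Lemma chi_2_digraphP (V : finType) (D : {set V * V}) : oriented D ->
  dipath2_colorable D (chi_2_digraph D) /\
  (forall k, dipath2_colorable D k -> (chi_2_digraph D <= k)%N).
Proof.
move=> /forallP Dor; rewrite /chi_2_digraph; case: arg_minnP => [|i Di imin].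
  apply/existsP; exists [ffun v => enum_rank v]; apply/andP; split.
    apply/forallP => u; apply/forallP => v; apply/implyP => uv.
    rewrite !ffunE (inj_eq enum_rank_inj); apply: contraL uv => /eqP ->.
    by apply/negP => vv; have /forallP/(_ v) := Dor v; rewrite vv.
  do 3![apply/forallP => ?]; apply/implyP => /andP[uv vw].
  rewrite !ffunE (inj_eq enum_rank_inj); apply: contraL vw => /eqP <-.
  by move: uv; apply/implyP; exact: (forallP (Dor _)).
split=> // k Dk; case: (ltnP k #|V|.+1) => [kV|/ltnW Vk].
  exact: (imin (Ordinal kV)).
by apply: leq_trans Vk; exact: (ltn_ord i).
Qed.

Definition chi_o (V : finType) (e : rel V) : nat :=
  \max_(D : {set V * V} | orientation e D) chi_o_digraph D.

Definition chi_2 (V : finType) (e : rel V) : nat :=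
  \max_(D : {set V * V} | orientation e D) chi_2_digraph D.

Definition homeomorphic (X Y : topologicalType) (A : set X) (B : set Y) :=
  exists (f : X -> Y) (h : Y -> X),
  [/\ {within A, continuous f}, {within B, continuous h},
      forall x, A x -> B (f x) /\ h (f x) = x
    & forall y, B y -> A (h y) /\ f (h y) = y].

(* Closed (compact, boundaryless), connected, nonempty 2-manifolds, orientable
   or not; second countability follows from compactness. *)
Definition surface (R : realType) (S : topologicalType) : Prop :=
  [/\ [set: S] !=set0, hausdorff_space S, compact [set: S],
      connected [set: S]
    & forall x : S, exists U : set S,
        [/\ open U, U x & homeomorphic U [set: 'rV[R]_2]]].

(* Points are families of barycentric coordinates indexed by the vertices. *)
Definition realization (R : realType) (W : finType) (K : {set {set W}}) :
    set 'rV[R]_(#|W|) :=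
  [set x | [/\ forall w : W, 0 <= x ord0 (enum_rank w),
               \sum_(w : W) x ord0 (enum_rank w) = 1
             & [set w : W | x ord0 (enum_rank w) != 0]%SET \in K]].

Definition simplicial_complex (W : finType) (K : {set {set W}}) : Prop :=
  (finset.set0 \notin K) /\
  (forall A B : {set W},
     A \in K -> B \subset A -> B != finset.set0 -> B \in K).

(* [z] and [w] are joined by an edge of the link of [v] in [K]. *)
Definition link_adj (W : finType) (K : {set {set W}}) (v : W) : rel W :=
  fun w z => ((v |: [set w; z])%SET \in K) && (#|(v |: [set w; z])%SET| == 3%N).

(* Triangulated closed surfaces: pure of dimension 2, and the link of every
   vertex is a cycle, i.e. a connected 2-regular graph. *)
Definition surface_complex (W : finType) (K : {set {set W}}) : Prop :=
  [/\ simplicial_complex K,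
      forall A, A \in K -> exists2 B, B \in K & A \subset B /\ #|B| = 3%N,
      forall A, A \in K -> (#|A| <= 3)%N,
      forall v w, v != w -> [set v; w]%SET \in K ->
        #|[set z | link_adj K v w z]%SET| = 2%N
    & forall v w w', v != w -> v != w' ->
        [set v; w]%SET \in K -> [set v; w']%SET \in K ->
        connect (link_adj K v) w w'].

Definition complex_euler_char (W : finType) (K : {set {set W}}) : int :=
  #|[set A in K | #|A| == 1%N]%SET|%:Z
  - #|[set A in K | #|A| == 2%N]%SET|%:Z
  + #|[set A in K | #|A| == 3%N]%SET|%:Z.

(* [c] is the Euler characteristic of [S], computed on a triangulation. *)
Definition is_euler_char (R : realType) (S : topologicalType) (c : int) :=
  exists (W : finType) (K : {set {set W}}),
  [/\ surface_complex K, homeomorphic (@realization R W K) [set: S]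
    & c = complex_euler_char K].

Definition graph_complex (V : finType) (e : rel V) : {set {set V}} :=
  [set A : {set V} | [exists u, A == [set u]%SET] ||
    [exists u, exists v, e u v && (A == [set u; v]%SET)]]%SET.

Definition graph_embeds (R : realType) (V : finType) (e : rel V)
    (S : topologicalType) : Prop :=
  exists A : set S, homeomorphic (@realization R V (graph_complex e)) A.

Definition is_euler_genus (R : realType) (V : finType) (e : rel V) (g : nat) :=
  (exists (S : topologicalType) (c : int),
     [/\ surface R S, graph_embeds R e S, is_euler_char R S c
       & 2 - c = g%:Z]) /\
  (forall (S : topologicalType) (c : int),
     surface R S -> graph_embeds R e S -> is_euler_char R S c ->
     g%:Z <= 2 - c).

(* Main.v *)
(* Coloring. Let g be the Euler genus. By Euler's formula every vertex set with more
   than 6g elements contains a vertex with at most 6 neighbors in that set. Hence, given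
   a 2-dipath coloring psi with k colors, a core of at most 6g vertices gets private
   colors and the other vertices v are added one by one, with a color (psi v, j), j < m.
   The colors form a tournament in which, whatever adjacencies to at most 6 colors
   outside the class c are prescribed, some (c, j) realizes them: a random tournament
   will do once m is a large multiple of log (k + g). In- and out-neighbors of a vertex
   never share a color since they have different psi-colors, so the prescriptions are
   consistent, and 6g + k m = O(k log k + g).

   Euler's formula. The surface is triangulated by K; subdivide each triangle of K into
   N^2 triangles, with vertices the points having barycentric coordinates in (1/N) Z.
   The stars of these vertices are small open sets, so for N large the embedded graph
   is a minor of the 1-skeleton: connected sets meet the stars of connected sets of
   vertices, and disjoint compact sets those of disjoint sets. Now contract spanning
   trees of the branch sets, delete the unused edges and merge the triangles on both
   sides of every deleted edge. Counting gives at least m - n + chi merged faces for m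
   edges and n vertices, and the boundary of each is a nonempty even subgraph of a simple
   graph, hence has at least 3 edges, so that 3 (m - n + chi) <= 2 m. *)
Require Import Defs.
From HB Require Import structures.
From mathcomp Require Import all_boot all_order all_algebra.
From mathcomp Require Import all_classical all_reals all_analysis.
From mathcomp Require Import zify ring lra.
Set Implicit Arguments.
Unset Strict Implicit.
Unset Printing Implicit Defensive.
Import Order.TTheory GRing.Theory Num.Theory.
Import numFieldNormedType.Exports.
(* Imported last, so that [setUC], [setP], [root], etc. denote the finite versions. *)
From mathcomp Require Import fintype finset bigop fingraph.
Local Open Scope nat_scope.

(** * Forests and even subgraphs *)

(** An embedding may be wild, so the faces of the drawn graph are never considered: connectedness of
    pieces of edges and disjointness of compact ones pass through the homeomorphisms, and the rest
    happens in a finite triangulation. There a merged face may fail to be a disc, so it has no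
    boundary walk; its boundary is taken modulo 2, which requires neither an orientation nor a
    cyclic order at vertices. With at least two merged faces these boundaries are nonempty because
    triangles are connected across edges ([strongly_connected]), which is more than connectedness of
    the 1-skeleton: a pinched vertex would break it. The counts are inequalities, since only an
    upper bound on the number of edges is wanted. For [n] vertices it is [3 n + 3 g - 3]: the usual
    [3 n + 3 g - 6], plus [3] to cover the case of a single merged face. Minimum degree 7 then
    forces [n <= 6 g - 6], whence the core size [6 g] and the degree [6]. The subdivision is the
    regular one because its degrees are at most 6 away from the corners, so that the Euler
    characteristic of [K] can be read off the degrees at the corners. *)

(** The depth is the length of a shortest [r]-path to [R], and the parent is any [r]-neighbor of
    smaller depth. [r] may be directed: in [minor_labelling] the allowed steps depend on their
    starting point. *)
Lemma bfs_forest (P : finType) (r : rel P) (R : pred P) :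
    (forall x, exists2 y, R y & connect r x y) ->
  exists (dep : P -> nat) (par : P -> P),
    forall x, ~~ R x -> r x (par x) /\ dep (par x) < dep x.
Proof.
move=> conR.
pose reach x n := [exists p : n.-tuple P, path r x p && R (last x p)].
have ex x : exists n, reach x n.
  have [y Ry /connectP [p rp yE]] := conR x; exists (size p).
  by apply/existsP; exists (in_tuple p); rewrite rp -yE.
pose dep x := ex_minn (ex x).
have step x : ~~ R x -> exists y, r x y && (dep y < dep x).
  move=> nRx; rewrite {2}/dep; case: ex_minnP => n /existsP[p /andP[rp Rp]] _.
  case: p rp Rp => -[|y p] /= szp; first by rewrite (negPf nRx).
  case/andP=> rxy ryp Ryp; exists y; rewrite rxy /=.
  rewrite /dep; case: ex_minnP => m _ /(_ (size p)) minm.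
  rewrite -(eqP szp) ltnS; apply: minm.
  by apply/existsP; exists (in_tuple p); rewrite ryp.
exists dep, (fun x => odflt x [pick y | r x y && (dep y < dep x)]) => x nRx.
case: pickP => [y /andP[]//|none].
by have [y] := step x nRx; rewrite none.
Qed.

Lemma set2_inj (T : finType) (x : T) : {in [pred y | y != x] &, injective (fun y => [set x; y])}.
Proof.
move=> y z; rewrite !inE => yx zx /setP /(_ y).
by rewrite !inE eqxx orbT (negPf yx) /= => /esym/eqP.
Qed.

Lemma handshake (T : finType) (E : {set {set T}}) :
    (forall A, A \in E -> #|A| = 2) ->
  \sum_p #|[set q | [set p; q] \in E]| = 2 * #|E|.
Proof.
move=> E2; rewrite mulnC -sum_nat_const.
transitivity (\sum_(A in E) \sum_(p in A) 1); last first.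
  by apply: eq_bigr => A /E2; rewrite sum1_card.
rewrite (exchange_big_dep predT) //=; apply: eq_bigr => p _.
rewrite sum1_card -(card_in_imset (f := fun q => [set p; q])); last first.
  apply: sub_in2 (@set2_inj _ p) => q; rewrite !inE => /E2.
  by rewrite cards2 eq_sym; case: eqP.
rewrite -[RHS]cardsE; congr #|pred_of_set _|; apply/setP=> A; rewrite !inE.
apply/imsetP/andP => [[q]|[AE pA]]; first by rewrite !inE => qE ->; rewrite qE !inE eqxx.
have /cards2P[x [y [xy AE2]]] : #|A| == 2 by rewrite E2.
move: pA AE; rewrite {A}AE2 !inE => /orP[] /eqP -> xyE.
  by exists y; rewrite ?inE.
by exists x; rewrite ?inE setUC.
Qed.

Lemma odd_sum (I : finType) (Q : pred I) (F : I -> nat) :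
  odd (\sum_(i | Q i) F i) = odd #|[set i | Q i && odd (F i)]|.
Proof.
rewrite -sum1dep_card big_mkcondr /=.
elim/big_ind2: _ => // [a b c d ab cd|i _]; first by rewrite !oddD ab cd.
by case: (odd (F i)).
Qed.

(* A vertex of an edge of [B] has another edge in [B], and following it once
   more cannot lead back to the first edge. *)
Lemma even_subgraph_ge3 (T : finType) (B : {set {set T}}) :
    (forall A, A \in B -> #|A| = 2) ->
    (forall v, ~~ odd #|[set A in B | v \in A]|) ->
  B != set0 -> 3 <= #|B|.
Proof.
move=> B2 ev /set0Pn [A AB].
have other v A0 : A0 \in B -> v \in A0 -> exists2 w, [set v; w] \in B & [set v; w] != A0.
  move=> A0B vA0; have := ev v; rewrite (cardsD1 A0) !inE A0B vA0 /=.
  case: (posnP #|[set A1 in B | v \in A1] :\ A0|) => [->//|].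
  rewrite card_gt0 => /set0Pn[A1]; rewrite !inE => /and3P[A10 A1B vA1] _.
  have /cards2P[x [y [xy A1E]]] : #|A1| == 2 by rewrite B2.
  move: vA1 A10 A1B; rewrite A1E !inE => /orP[]/eqP-> A10 A1B; first by exists y.
  by exists x; rewrite setUC.
have /cards2P[u [v [uv AE]]] : #|A| == 2 by rewrite B2.
have [|w vwB vwA] := other v A AB; first by rewrite AE !inE eqxx orbT.
have [|x wxB wxvw] := other w _ vwB; first by rewrite !inE eqxx orbT.
have vw : v != w by have := B2 _ vwB; rewrite cards2; case: eqP.
have wu : w != u by apply: contraNneq vwA => ->; rewrite AE setUC.
suff /subset_leq_card : [set A; [set v; w]; [set w; x]] \subset B.
  apply: leq_trans; rewrite -setUA cardsU1 !inE cards2 negb_or eq_sym vwA eq_sym /=.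
  have -> : [set w; x] != A.
    apply/eqP => /setP/(_ w); rewrite AE !inE eqxx /=.
    by rewrite (negPf wu) eq_sym (negPf vw).
  by rewrite eq_sym wxvw.
by apply/subsetP => Z; rewrite !inE => /orP[/orP[]|] /eqP->.
Qed.

(** The path is followed only up to its first vertex in [G], since [r'] may forbid further steps of
    [r] from there on. *)
Lemma connect_in_sub (T : finType) (r r' : rel T) (Z : pred T) (G : pred T) x y :
    connect (fun a b => [&& r a b, Z a & Z b]) x y -> Z x -> G y ->
    (forall a b, r a b -> Z a -> Z b -> ~~ G a -> r' a b) ->
  exists2 z, G z & connect r' x z.
Proof.
move=> /connectP[p pp ->] {y} + + rr'; elim: p x pp => [|z p IH] x /=.
  by move=> _ _ Gx; exists x.
case/andP=> /and3P[rxz _ Zz] pp Zx Gy.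
have [Gx|nGx] := boolP (G x); first by exists x.
have [w Gw zw] := IH z pp Zz Gy; exists w => //.
exact: connect_trans (connect1 (rr' _ _ rxz Zx Zz nGx)) zw.
Qed.

(** * Triangle complexes, boundaries modulo 2 and minors *)

Definition graph_edges (V : finType) (e : rel V) : {set {set V}} :=
  [set A | [exists u, exists v, e u v && (A == [set u; v])]].

Definition face_edges (P : finType) (F : {set {set P}}) : {set {set P}} :=
  [set E : {set P} | (#|E| == 2) && [exists f in F, E \subset f]].

Definition face_adj (P : finType) (F : {set {set P}}) : rel P :=
  fun p q => [set p; q] \in face_edges F.

Definition pseudosurface (P : finType) (F : {set {set P}}) : Prop :=
  (forall f, f \in F -> #|f| = 3) /\
  (forall E, E \in face_edges F -> #|[set f in F | E \subset f]| = 2).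

(** Connectedness of the dual graph, phrased for sets of faces closed under crossing an edge: a
    class of faces with empty boundary is such a set. *)
Definition strongly_connected (P : finType) (F : {set {set P}}) : Prop :=
  forall C : {set {set P}}, C \subset F -> C != set0 ->
    (forall f f', f \in C -> f' \in F -> #|f :&: f'| = 2 -> f' \in C) ->
  C = F.

Definition connected_in (P : finType) (r : rel P) (A : {set P}) : Prop :=
  {in A &, forall p q, connect (fun a b => [&& r a b, a \in A & b \in A]) p q}.

Lemma face_adj_sym (P : finType) (F : {set {set P}}) : symmetric (face_adj F).
Proof. by move=> p q; rewrite /face_adj setUC. Qed.

Lemma pseudosurface_card (P : finType) (F : {set {set P}}) :
  pseudosurface F -> 3 * #|F| = 2 * #|face_edges F|.
Proof.
case=> F3 F2; rewrite mulnC -sum_nat_const [RHS]mulnC -sum_nat_const.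
transitivity (\sum_(f in F) \sum_(E in face_edges F | E \subset f) 1).
  apply: eq_bigr => f fF; rewrite sum1dep_card.
  transitivity #|[set E : {set P} | E \subset f & #|E| == 2]|.
    by rewrite cards_draws F3.
  congr #|pred_of_set _|; apply/setP => E; rewrite !inE.
  case: (boolP (E \subset f)) => Ef; rewrite ?andbT ?andbF //=.
  case: eqP => //= _; apply/esym/existsP; exists f; exact/andP.
rewrite (exchange_big_dep (fun E => E \in face_edges F)) /=; last by move=> f E _ /andP[].
apply: eq_bigr => E EF; rewrite sum1dep_card -(F2 _ EF).
by apply: eq_card => f; rewrite !inE; move: EF; rewrite inE => ->.
Qed.

Lemma connect_switch (T : finType) (r : rel T) (Q : pred T) x y :
  connect r x y -> Q x -> ~~ Q y -> exists a b, [/\ r a b, Q a & ~~ Q b].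
Proof.
move=> /connectP[p pp ->] {y}; elim: p x pp => [|z p IH] x /=; first by move=> _ ->.
case/andP=> rxz pz Qx; have [Qz|nQz] := boolP (Q z); first exact: IH.
by exists x, z.
Qed.

Definition forest (P : finType) (R : pred P) (dep : P -> nat) (par : P -> P) : Prop :=
  forall x, ~~ R x -> dep (par x) < dep x.

Lemma forest_top (P : finType) (R : pred P) dep par : forest R dep par ->
  exists top : P -> P, forall x,
    [/\ R (top x), R x -> top x = x & ~~ R x -> top x = top (par x)].
Proof.
move=> fo; pose f y := if R y then y else par y.
have Rit m x : dep x <= m -> R (iter m f x).
  elim: m x => [|m IH] x dx.
    by apply: contraT => /fo; move: dx; rewrite leqn0 => /eqP->.
  rewrite iterSr; have [Rx|nRx] := boolP (R x); last first.
    by rewrite /f (negPf nRx); apply: IH; rewrite -ltnS; apply: leq_trans (fo _ nRx) dx.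
  rewrite /f Rx; elim: m {IH dx} => //= m; rewrite -/f => Rm; by rewrite /f Rm.
pose n := \max_x dep x; exists (iter n f) => x.
have Rn y : R (iter n f y) by apply: Rit; rewrite /n (bigD1 y) //= leq_maxl.
split=> // [Rx|nRx].
  by elim: (n) => //= m ->; rewrite /f Rx.
have fx : f x = par x by rewrite /f (negPf nRx).
by rewrite -fx -iterSr /= {2}/f Rn.
Qed.

Lemma forest_edge_inj (P : finType) (R : pred P) dep par : forest R dep par ->
  {in [pred x | ~~ R x] &, injective (fun x => [set x; par x])}.
Proof.
move=> fo x y; rewrite !inE => /fo dx /fo dy E.
have : x \in [set y; par y] by rewrite -E !inE eqxx.
rewrite !inE => /orP[/eqP//|/eqP xE].
have : y \in [set x; par x] by rewrite E !inE eqxx.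
rewrite !inE => /orP[/eqP//|/eqP yE].
by move: dx dy; rewrite -xE -yE => dx /(ltn_trans dx); rewrite ltnn.
Qed.

(** Among the vertices whose parent edge is in [B], a deepest one would have degree 1 in [B]. *)
Lemma forest_acyclic (P : finType) (R : pred P) dep par (B : {set {set P}}) :
    forest R dep par -> B \subset [set [set x; par x] | x in [pred x | ~~ R x]] ->
    (forall p, ~~ odd #|[set E in B | p \in E]|) ->
  B = set0.
Proof.
move=> fo BT ev; apply/eqP; apply: contraT => /set0Pn[E0 E0B].
have /imsetP[x0 nRx0 E0E] := subsetP BT _ E0B.
pose Q x := ~~ R x && ([set x; par x] \in B).
have Qx0 : Q x0 by rewrite /Q -E0E E0B andbT.
case: (arg_maxnP dep Qx0) => x /andP[nRx xB] xmax.
suff E1 : [set E in B | x \in E] = [set [set x; par x]] by have := ev x; rewrite E1 cards1.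
apply/setP => E; rewrite !inE; apply/andP/eqP => [[EB]|->]; last by rewrite !inE eqxx.
have /imsetP[y nRy EE] := subsetP BT _ EB; rewrite EE !inE => /orP[/eqP->//|/eqP xE].
have : Q y by rewrite /Q -EE EB andbT; exact: nRy.
by move/xmax; rewrite xE => /leq_ltn_trans /(_ (fo _ nRy)); rewrite ltnn.
Qed.

(** The classes are the components of the dual graph whose edges are those of [D], that is, the
    faces obtained by erasing [D]. A spanning forest of this graph has at most [#|D|] edges. *)
Lemma dual_components (P : finType) (F D : {set {set P}}) :
    pseudosurface F -> D \subset face_edges F ->
  exists cls : {set P} -> {set P},
    #|F| <= #|cls @: F| + #|D| /\
    (forall f f' E, f \in F -> f' \in F -> E \in D -> E \subset f -> E \subset f' ->
       cls f = cls f').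
Proof.
move=> [F3 F2] DF.
pose dr : rel {set P} := fun f f' =>
  [&& f \in F, f' \in F & [exists E in D, (E \subset f) && (E \subset f')]].
have dsym : symmetric dr.
  move=> f f'; rewrite /dr andbCA; do 2!congr (_ && _).
  by apply: eq_existsb => E; rewrite [X in _ && X]andbC.
have csym := sym_connect_sym dsym.
have [|dep [par fo]] := @bfs_forest _ dr (roots dr).
  by move=> f; exists (root dr f); [exact: roots_root|exact: connect_root].
exists (root dr); split; last first.
  move=> f f' E fF f'F ED Ef Ef'; apply/eqP; rewrite root_connect //; apply: connect1.
  by rewrite /dr fF f'F; apply/existsP; exists E; rewrite ED Ef.
pose sh (f : {set P}) : {set P} := odflt set0 [pick E in D | (E \subset f) && (E \subset par f)].
have shP (f : {set P}) : ~~ roots dr f -> [/\ f \in F, par f \in F, sh f \in D, sh f \subset f & sh f \subset par f].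
  move=> /fo[/and3P[fF pF /existsP[E ED]] _]; rewrite /sh.
  by case: pickP => [E' /and3P[]//|/(_ E)]; rewrite ED.
have foF : forest (roots dr) dep par by move=> f /fo[].
(* A non-root face and its parent are the only two faces at their shared edge, so [sh f] determines
   this pair, hence [f] by [forest_edge_inj]. *)
have shinj : {in [pred f | ~~ roots dr f] &, injective sh}.
  move=> f f' nf nf' E; rewrite !inE in nf nf'.
  have [fF pF shD sf sp] := shP _ nf; have [f'F p'F _ sf' sp'] := shP _ nf'.
  have Fsh := subsetP DF _ shD.
  have two (g g' : {set P}) : g \in F -> g' \in F -> sh f \subset g -> sh f \subset g' -> g != g' ->
      [set k in F | sh f \subset k] = [set g; g'].
    move=> gF g'F sg sg' gg'; apply/esym/eqP.
    rewrite eqEcard cards2 gg' F2 // andbT.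
    by apply/subsetP => h; rewrite !inE => /orP[]/eqP->; apply/andP.
  have ne (h : {set P}) : ~~ roots dr h -> h != par h.
    by move/foF; apply: contraTneq => <-; rewrite ltnn.
  have := two _ _ fF pF sf sp (ne _ nf); rewrite (two _ _ f'F p'F) -?E ?ne //; last by rewrite E.
    by move=> /esym; apply: (forest_edge_inj foF).
  by rewrite E.
rewrite -(cardsID [set f | roots dr f] F) leq_add //.
  apply: subset_leq_card; apply/subsetP => f; rewrite !inE => /andP[fF /eqP fE].
  by rewrite -fE imset_f.
rewrite -(card_in_imset (f := sh)); last first.
  by apply: sub_in2 shinj => f; rewrite !inE => /andP[].
apply: subset_leq_card; apply/subsetP => E /imsetP[f]; rewrite !inE => /andP[nf _] ->.
by have [] := shP f nf.
Qed.

(** The boundary modulo 2 of the 2-chain [C]. *)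
Definition boundary (P : finType) (C : {set {set P}}) (F : {set {set P}}) : {set {set P}} :=
  [set E in face_edges F | odd #|[set f in C | E \subset f]|].

(** The boundary of a boundary vanishes modulo 2: a triangle has two edges at each of its corners
    ([3 - 1] pairs) and none at any other point ([3 - 3]). *)
Lemma even_boundary (P : finType) (F C : {set {set P}}) (p : P) :
    (forall f, f \in F -> #|f| = 3) -> C \subset F ->
  ~~ odd #|[set E in boundary C F | p \in E]|.
Proof.
move=> F3 CF.
have -> : [set E in boundary C F | p \in E] =
    [set E in [set E in face_edges F | p \in E] | odd #|[set f in C | E \subset f]|].
  by apply/setP => E; rewrite !inE andbAC.
rewrite -odd_sum.
under eq_bigr do rewrite -sum1dep_card.
rewrite (exchange_big_dep (fun f => f \in C)) /=; last by move=> E f _ /andP[].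
elim/big_rec: _ => // f n fC; rewrite oddD => /negPf ->; rewrite addbF.
have fF := subsetP CF _ fC.
have -> : \sum_(E in [set E in face_edges F | p \in E] | (f \in C) && (E \subset f)) 1
   = #|[set E : {set P} | (E \subset f) && (#|E| == 2)] :\:
       [set E : {set P} | (E \subset f :\ p) && (#|E| == 2)]|.
  rewrite sum1dep_card; apply: eq_card => E; rewrite !inE fC /=.
  rewrite subsetD1; case: (#|E| == 2); rewrite ?andbF ?andbT //=.
  case: (boolP (E \subset f)) => Ef; rewrite ?andbF ?andbT //= negbK.
  by rewrite andb_idl // => _; apply/existsP; exists f; rewrite fF.
have sub : [set E : {set P} | (E \subset f :\ p) && (#|E| == 2)] \subset
   [set E : {set P} | (E \subset f) && (#|E| == 2)].
  apply/subsetP => E; rewrite !inE => /andP[Efp ->]; rewrite andbT.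
  exact: subset_trans Efp (subsetDl _ _).
rewrite cardsD (setIidPr sub) !cards_draws.
by have := cardsD1 p f; rewrite F3 //; case: (p \in f); [rewrite add1n => -[<-]|rewrite add0n => <-].
Qed.

(** The even degrees in [B] are summed over the fibre of [v] under [lab]. An edge of [T] has both
    ends or no end in the fibre, and [h A] has exactly one end there when [v] is in [A], none
    otherwise. *)
Lemma even_contraction (P V : finType) (T B : {set {set P}}) (EG : {set {set V}})
    (lab : P -> V) (h : {set V} -> {set P}) (v : V) :
    (forall E, E \in B -> #|E| = 2) -> (forall A, A \in EG -> #|A| = 2) ->
    (forall A, A \in EG -> lab @: h A = A) ->
    (forall E, E \in T -> {in E &, forall x y, lab x = lab y}) ->
    B \subset T :|: h @: EG ->
    (forall p, ~~ odd #|[set E in B | p \in E]|) ->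
  ~~ odd #|[set A in [set A in EG | h A \in B] | v \in A]|.
Proof.
move=> B2 G2 hK Tlab BTh ev.
have hinj : {in EG &, injective h} by move=> A A' /hK {2}<- /hK {2}<- ->.
have : ~~ odd (\sum_(p | lab p == v) #|[set E in B | p \in E]|).
  by elim/big_rec: _ => // p n _; rewrite oddD (negPf (ev p)).
under eq_bigr do rewrite -sum1dep_card.
rewrite (exchange_big_dep (fun E => E \in B)) /=; last by move=> p E _ /andP[].
under eq_bigr => E EB do rewrite sum1dep_card EB /=.
rewrite odd_sum; congr (~~ odd _).
rewrite -(card_in_imset (f := h)); last first.
  by apply: sub_in2 hinj => A; rewrite !inE => /andP[/andP[]].
apply: eq_card => E; rewrite !inE; apply/andP/imsetP => [[EB]|[A]]; last first.
  rewrite !inE => /andP[/andP[AE hB] vA] ->; split=> //.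
  have inj : {in h A &, injective lab} by apply/imset_injP; rewrite hK // G2 // B2.
  have [p ph pv] : exists2 p, p \in h A & v = lab p by apply/imsetP; rewrite hK.
  suff -> : [set i | (lab i == v) && (i \in h A)] = [set p] by rewrite cards1.
  apply/setP => q; rewrite !inE; apply/andP/eqP => [[/eqP qv qh]|->]; last by rewrite pv.
  by apply: inj; rewrite // qv.
have /setUP[ET|/imsetP[A AE EE]] := subsetP BTh _ EB; last first.
  move=> od; exists A => //; rewrite !inE AE -EE EB /=.
  have : #|[set i | (lab i == v) && (i \in E)]| != 0 by apply: contraTneq od => ->.
  rewrite cards_eq0 => /set0Pn[p]; rewrite !inE => /andP[/eqP <- pE].
  by rewrite -(hK _ AE) -EE imset_f.
case: (pickP (fun p => (p \in E) && (lab p == v))) => [p /andP[pE /eqP pv]|no].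
  have -> : [set i | (lab i == v) && (i \in E)] = E.
    apply/setP => q; rewrite !inE andb_idl // => qE.
    by rewrite -pv (Tlab E ET q p).
  by rewrite B2.
have -> : [set i | (lab i == v) && (i \in E)] = set0; last by rewrite cards0.
by apply/setP => q; rewrite !inE andbC no.
Qed.

(* [X v] are the branch sets of the vertices of [e] and [Y u v] the bridges that
   carry its edges, so that [e] is a minor of the graph [face_adj F]. *)
Definition minor_model (P V : finType) (F : {set {set P}}) (e : rel V)
    (X : V -> {set P}) (Y : V -> V -> {set P}) : Prop :=
  [/\ forall v, X v != set0 /\ connected_in (face_adj F) (X v),
      forall u v, u != v -> [disjoint X u & X v],
      forall u v, e u v -> [/\ connected_in (face_adj F) (Y u v),
        X u :&: Y u v != set0 & X v :&: Y u v != set0],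
      forall u v w, e u v -> w \notin [set u; v] -> [disjoint X w & Y u v]
    & forall u v u' v', e u v -> e u' v' -> [set u; v] != [set u'; v'] ->
        [disjoint Y u v & Y u' v']].

(** The branch sets are enlarged to a partition of [P] into trees, [lab] naming the tree of each
    point. Trees must respect the model: points of [X v] get label [v], those of [Y u v] label [u]
    or [v]. *)
Lemma minor_labelling (P V : finType) (F : {set {set P}}) (e : rel V) X Y (v0 : V) :
    irreflexive e -> minor_model F e X Y -> connected_in (face_adj F) [set: P] ->
  exists (rt : V -> P) (dep : P -> nat) (par : P -> P) (lab : P -> V),
    [/\ injective rt, forest [pred x in codom rt] dep par,
        forall x, x \notin codom rt -> face_adj F x (par x) /\ lab (par x) = lab x
      & forall u v, e u v -> exists p q, [/\ face_adj F p q, lab p = u & lab q = v]].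
Proof.
move=> eirr [Xc Xd Yc XYd Yd] Pc.
have rtE v : exists p, p \in X v by have [/set0Pn] := Xc v.
pose rt v := xchoose (rtE v).
have rtX v : rt v \in X v by exact: xchooseP.
have Xu u v p : p \in X u -> p \in X v -> u = v.
  move=> pu pv; apply/eqP; apply: contraT => /Xd /pred0P /(_ p) /=.
  by rewrite pu pv.
have rtI : injective rt by move=> u v E; apply: (Xu _ _ (rt u)); rewrite ?rtX // E rtX.
pose inX p := [exists v, p \in X v].
pose inY p := [exists u, exists v, e u v && (p \in Y u v)].
(* From a branch set one may only step inside it, from a bridge only along the bridge until a branch
   set is met, and from elsewhere anywhere. Parents chosen along [r] thus keep the labels under
   control. *)
pose r p q := face_adj F p q &&
  (if inX p then [exists v, (p \in X v) && (q \in X v)]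
   else if inY p then [exists u, exists v, [&& e u v, p \in Y u v & q \in Y u v]]
   else true).
have con1 p v : p \in X v -> connect r p (rt v).
  move=> pX; have [_ /(_ _ _ pX (rtX v))] := Xc v; apply: connect_sub => a b.
  case/and3P=> ab aX bX; apply: connect1; rewrite /r ab /=.
  have -> : inX a by apply/existsP; exists v.
  by apply/existsP; exists v; rewrite aX.
have toX p q : inX q -> connect r p q -> exists2 y, y \in codom rt & connect r p y.
  case/existsP=> v qv pq; exists (rt v); first exact: codom_f.
  exact: connect_trans pq (con1 _ _ qv).
have con2 p : inY p -> exists2 y, y \in codom rt & connect r p y.
  case/existsP=> u /existsP[v /andP[euv pY]].
  have [Ycon /set0Pn[q /setIP[qX qY]] _] := Yc _ _ euv.
  have inXq : inX q by apply/existsP; exists u.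
  have [|z Xz pz] := connect_in_sub (r' := r) (Ycon _ _ pY qY) pY inXq; last exact: toX pz.
  move=> a b ab aY bY nXa; rewrite /r ab (negPf nXa) /=.
  case: ifP => // _; apply/existsP; exists u; apply/existsP; exists v.
  by rewrite euv aY.
have conr p : exists2 y, y \in codom rt & connect r p y.
  have /Pc/(_ (in_setT p)) := in_setT (rt v0).
  have symA : connect_sym (fun a b => [&& face_adj F a b, a \in [set: P] & b \in [set: P]]).
    by apply: sym_connect_sym => a b; rewrite face_adj_sym !inE.
  rewrite symA => pr.
  have Q0 : inX (rt v0) || inY (rt v0) by apply/orP; left; apply/existsP; exists v0.
  have [|z + pz] := connect_in_sub (r' := r) (G := [pred x | inX x || inY x]) pr (in_setT p) Q0.
    by move=> a b ab _ _ /norP[/negPf aX /negPf aY]; rewrite /r ab aX aY.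
  case/orP => [Xz|/con2[y yR zy]]; first exact: toX pz.
  by exists y => //; apply: connect_trans pz zy.
have [dep [par fo]] := bfs_forest conr.
have foF : forest [pred x in codom rt] dep par by move=> x /fo[].
have [top topP] := forest_top foF.
pose lab p := odflt v0 [pick v | rt v == top p].
have labE p v : rt v = top p -> lab p = v.
  rewrite /lab => E; case: pickP => [w /eqP wE|/(_ v)]; last by rewrite E eqxx.
  by apply: rtI; rewrite wE E.
have lab_par x : x \notin codom rt -> lab (par x) = lab x.
  by move=> nx; rewrite /lab; have [_ _ tp] := topP x; rewrite tp.
have labX p v : p \in X v -> lab p = v.
  have [n] := ubnP (dep p); elim: n p => // n IH p dn pX.
  have [/codomP[w pw]|np] := boolP (p \in codom rt).
    apply: labE; have [_ tp _] := topP p; rewrite tp; last by rewrite pw; exact: codom_f.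
    by rewrite pw; congr rt; apply: (Xu _ _ p); rewrite ?pw // -pw.
  have [/andP[_]] := fo p np; have -> : inX p by apply/existsP; exists v.
  case/existsP => w /andP[pw pw'] dp; rewrite -lab_par //; apply: IH.
    by apply: leq_trans dp _.
  by rewrite (Xu _ _ _ pX pw).
have labY p u v : e u v -> p \in Y u v -> lab p \in [set u; v].
  have [n] := ubnP (dep p); elim: n p u v => // n IH p u v dn euv pY.
  have [Xp|nXp] := boolP (inX p).
    case/existsP: Xp => w pw; rewrite (labX _ _ pw); apply: contraT => /(XYd _ _ _ euv).
    by move=> /pred0P/(_ p) /=; rewrite pw pY.
  have np : p \notin codom rt.
    by apply: contra nXp => /codomP[w ->]; apply/existsP; exists w.
  have [/andP[_]] := fo p np; rewrite (negPf nXp).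
  have -> : inY p by apply/existsP; exists u; apply/existsP; exists v; rewrite euv.
  case/existsP=> u' /existsP[v' /and3P[euv' pY' ppY']] dp.
  have E : [set u; v] = [set u'; v'].
    by apply/eqP; apply: contraT => /(Yd _ _ _ _ euv euv') /pred0P /(_ p) /=; rewrite pY pY'.
  by rewrite -lab_par // E; apply: IH => //; apply: leq_trans dp _.
exists rt, dep, par, lab; split=> //.
  by move=> x nx; split; [have [/andP[]] := fo x nx|exact: lab_par].
move=> u v euv; have [Ycon /set0Pn[p /setIP[pX pY]] /set0Pn[q /setIP[qX qY]]] := Yc _ _ euv.
have uv : u != v by apply: contraTneq euv => ->; rewrite eirr.
(* The bridge leads from label [u] to label [v] and carries no other label, so some step on it
   switches from one to the other. *)
have [||a [b [/and3P[ab aY bY] /eqP au bu]]] := connect_switch (Q := [pred x | lab x == u]) (Ycon _ _ pY qY).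
- by rewrite /= (labX _ _ pX).
- by rewrite /= (labX _ _ qX) eq_sym.
exists a, b; split=> //; have := labY _ _ _ euv bY.
by move: bu; rewrite /= !inE => /negPf-> /eqP.
Qed.

(** With [c] merged faces and [D] the erased edges, [c >= #|F| - #|D|], [#|D| = #|face_edges F| -
    (#|P| - #|V|) - #|graph_edges e|] and [3 #|F| = 2 #|face_edges F|]. The bound follows from
    [3 c <= 2 #|graph_edges e| + 3]. *)
Lemma labelled_bound (P V : finType) (F : {set {set P}}) (e : rel V) (rt : V -> P) dep par lab :
    irreflexive e -> pseudosurface F -> strongly_connected F ->
    injective rt -> forest [pred x in codom rt] dep par ->
    (forall x, x \notin codom rt -> face_adj F x (par x) /\ lab (par x) = lab x) ->
    (forall u v, e u v -> exists p q, [/\ face_adj F p q, lab p = u & lab q = v]) ->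
  3 * #|P| + #|graph_edges e| <= 3 * #|V| + #|face_edges F| + 3.
Proof.
move=> eirr Fps Fsc rtI fo parP edP; have [F3 F2] := Fps.
set EG := graph_edges e.
have EG2 A : A \in EG -> #|A| = 2.
  rewrite inE => /existsP[u /existsP[v /andP[euv /eqP ->]]]; rewrite cards2.
  by case: eqP euv => // ->; rewrite eirr.
have FE2 E : E \in face_edges F -> #|E| = 2 by rewrite inE => /andP[/eqP].
pose T := [set [set x; par x] | x in [pred x | x \notin codom rt]].
have TF : T \subset face_edges F.
  by apply/subsetP => E /imsetP[x nx ->]; have [] := parP x nx.
have Tlab E : E \in T -> {in E &, forall x y, lab x = lab y}.
  move=> /imsetP[x nx ->]; have [_ lx] := parP x nx.
  by move=> y z; rewrite !inE => /orP[]/eqP-> /orP[]/eqP->.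
have Tcard : #|T| + #|V| = #|P|.
  rewrite card_in_imset; last exact: forest_edge_inj fo.
  rewrite -(card_codom rtI) addnC -(cardC [in codom rt]); congr (_ + _).
(* One representative in the triangulation for each edge of [e]; its parallel copies go to [D]. *)
pose h A := odflt set0 [pick E in face_edges F | lab @: E == A].
have hP A : A \in EG -> h A \in face_edges F /\ lab @: h A = A.
  move=> AE; rewrite /h; case: pickP => [E /andP[EF /eqP]//|no].
  move: AE; rewrite inE => /existsP[u /existsP[v /andP[/edP[p [q [pq pu qv]]] /eqP AE]]].
  by have := no [set p; q]; rewrite -[_ \in _]/(face_adj F p q) pq imsetU1 imset_set1 pu qv AE eqxx.
have hK A : A \in EG -> lab @: h A = A by case/hP.
have hinj : {in EG &, injective h} by move=> A A' /hK {2}<- /hK {2}<- ->.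
have hF : h @: EG \subset face_edges F by apply/subsetP => E /imsetP[A /hP[hA _] ->].
have Th : [disjoint T & h @: EG].
  apply/pred0P => E /=; apply/negP => /andP[ET /imsetP[A AE EE]].
  have /cards2P[u [v [uv Auv]]] : #|A| == 2 by rewrite EG2.
  have [p pE pu] : exists2 p, p \in E & u = lab p.
    by apply/imsetP; rewrite EE hK // Auv !inE eqxx.
  have [q qE qv] : exists2 q, q \in E & v = lab q.
    by apply/imsetP; rewrite EE hK // Auv !inE eqxx orbT.
  by move: uv; rewrite pu qv (Tlab E ET p q) // eqxx.
pose D := face_edges F :\: (T :|: h @: EG).
have Ecard : #|face_edges F| = #|D| + #|T| + #|EG|.
  have sub : T :|: h @: EG \subset face_edges F by rewrite subUset TF.
  rewrite -(cardsID (T :|: h @: EG) (face_edges F)) -/D (setIidPr sub).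
  by rewrite cardsU disjoint_setI0 // cards0 subn0 (card_in_imset hinj) addnC addnA.
have [cls [clsle clsD]] := dual_components Fps (subsetDl _ (T :|: h @: EG) : D \subset face_edges F).
(* The final [3] pays for a single merged face: the boundary of all of [F] is empty, since every
   edge has two sides. *)
suff main : 3 * #|cls @: F| <= 2 * #|EG| + 3.
  have := pseudosurface_card Fps; move: main clsle Ecard Tcard.
  move: #|F| #|cls @: F| #|EG| #|D| #|face_edges F| #|T| #|V| #|P|; lia.
have [le1|gt1] := leqP #|cls @: F| 1; first lia.
pose C j := [set f in F | cls f == j].
have CF j : C j \subset F by apply/subsetP => f; rewrite inE => /andP[].
pose bG j := [set A in EG | h A \in boundary (C j) F].
have bT j : boundary (C j) F \subset T :|: h @: EG.
  apply/subsetP => E; rewrite inE => /andP[EF od]; apply: contraT => nE.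
  have ED : E \in D by rewrite inE nE.
  (* The two faces at an edge of [D] are in the same class, so such an edge counts 0 or 2 times in
     each class. *)
  suff : [set f in C j | E \subset f] = set0 \/ [set f in C j | E \subset f] = [set f in F | E \subset f].
    by case=> X; move: od; rewrite X ?cards0 // F2.
  have [->|/set0Pn[f]] := eqVneq [set f in C j | E \subset f] set0; first by left.
  rewrite !inE => /andP[/andP[fF /eqP fj] Ef]; right; apply/setP => f'; rewrite !inE.
  case: (boolP (f' \in F)) => //= f'F; case: (boolP (E \subset f')) => Ef'; rewrite ?andbF //.
  by rewrite andbT -fj (clsD f f' E) ?eqxx.
have bG3 j : j \in cls @: F -> 3 <= #|bG j|.
  move=> /imsetP[f fF jE].
  have bn0 : boundary (C j) F != set0.
    have [j' j'F j'j] : exists2 j', j' \in cls @: F & j' != j.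
      case: (pickP [pred j' in cls @: F | j' != j]) => [j' /andP[? ?]|no]; first by exists j'.
      suff /subset_leq_card : cls @: F \subset [set j] by rewrite cards1 leqNgt gt1.
      by apply/subsetP => k kF; have := no k; rewrite /= kF inE => /negbFE.
    (* A class with empty boundary is closed under crossing edges, hence is all of [F], which
       excludes a second class. *)
    apply: contraTneq j'j => b0; have /imsetP[f' f'F j'E] := j'F; rewrite negbK.
    suff CE : C j = F by move: f'F; rewrite -CE inE -j'E => /andP[].
    apply: Fsc => //; first by apply/set0Pn; exists f; rewrite inE fF jE eqxx.
    move=> g g' gC g'F gg'; apply: contraT => g'C.
    have gF := subsetP (CF j) _ gC.
    have EF : g :&: g' \in face_edges F.
      by rewrite inE gg' eqxx; apply/existsP; exists g; rewrite gF subsetIl.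
    suff : g :&: g' \in boundary (C j) F by rewrite b0 inE.
    rewrite inE EF; suff -> : [set f in C j | g :&: g' \subset f] = [set g] by rewrite cards1.
    have gg : [set f in F | g :&: g' \subset f] = [set g; g'].
      apply/esym/eqP; rewrite eqEcard F2 // cards2.
      have -> : g != g' by apply: contraNneq g'C => <-.
      rewrite andbT; apply/subsetP => k; rewrite !inE.
      by case/orP => /eqP->; rewrite ?gF ?g'F ?subsetIl ?subsetIr.
    apply/setP => k; rewrite !inE; apply/andP/eqP => [[kC sk]|->]; last first.
      by rewrite subsetIl gF; split=> //; move: gC; rewrite inE => /andP[].
    have /setP/(_ k) := gg; rewrite !inE sk (andP kC).1 /= => /esym/orP[/eqP//|/eqP kg'].
    by move: g'C; rewrite inE -kg' kC.
  have B2 E : E \in boundary (C j) F -> #|E| = 2 by rewrite inE => /andP[/FE2].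
  have ev p : ~~ odd #|[set E in boundary (C j) F | p \in E]| by exact: even_boundary.
  apply: even_subgraph_ge3 => [A|v|]; first by rewrite inE => /andP[/EG2].
    exact: even_contraction B2 EG2 hK Tlab (bT j) ev.
  (* If contraction left nothing, the boundary would be an even subgraph of the forest [T], hence
     empty. *)
  apply: contraNneq bn0 => bG0; apply/eqP; apply: forest_acyclic fo _ ev.
  apply/subsetP => E Eb; have /setUP[//|/imsetP[A AE EE]] := subsetP (bT j) _ Eb.
  have : A \in bG j by rewrite inE AE -EE.
  by rewrite bG0 inE.
have -> : 3 * #|cls @: F| = \sum_(j in cls @: F) 3 by rewrite sum_nat_const mulnC.
apply: leq_trans (leq_addr _ _).
apply: (@leq_trans (\sum_(j in cls @: F) #|bG j|)); first exact: leq_sum.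
under eq_bigr do rewrite -sum1dep_card.
rewrite (exchange_big_dep (fun A => A \in EG)) /=; last by move=> j A _ /andP[].
(* An edge bounds at most two classes, since it has only two faces. *)
rewrite mulnC -sum_nat_const; apply: leq_sum => A AE; rewrite sum1dep_card.
have [hAF _] := hP _ AE; rewrite -(F2 _ hAF).
apply: leq_trans (leq_imset_card cls _); apply: subset_leq_card.
apply/subsetP => j; rewrite !inE => /andP[_ /andP[_ /andP[_ od]]].
have : #|[set f in C j | h A \subset f]| != 0 by apply: contraTneq od => ->.
rewrite cards_eq0 => /set0Pn[f]; rewrite !inE => /andP[/andP[fF /eqP <-] hf].
by rewrite imset_f // inE fF.
Qed.

Lemma minor_edge_bound (P V : finType) (F : {set {set P}}) (e : rel V) X Y :
    irreflexive e -> pseudosurface F -> strongly_connected F ->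
    connected_in (face_adj F) [set: P] -> minor_model F e X Y -> 0 < #|V| ->
  3 * #|P| + #|graph_edges e| <= 3 * #|V| + #|face_edges F| + 3.
Proof.
move=> eirr Fps Fsc Fc XY /card_gt0P[v0 _].
have [rt [dep [par [lab [rtI fo parP edP]]]]] := minor_labelling v0 eirr XY Fc.
exact: labelled_bound fo parP edP.
Qed.

(** * Subdivision of a triangulated surface *)

(* Keeps only the hypotheses over [nat], since [lia] splits on the boolean ones. *)
Ltac nat_lia :=
  intros;
  repeat match goal with
  | H : @eq ?T _ _ |- _ => unify T nat; revert H
  | H : is_true (leq _ _) |- _ => revert H
  | H : _ /\ _ |- _ => revert H
  | H : _ \/ _ |- _ => revert H
  | H : ~ (_ /\ _) |- _ => revert H
  | H : is_true (~~ @eq_op ?T _ _) |- _ => unify (Equality.sort T) nat; revert H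
  end; clear; intros; lia.

Definition grid_point (W : finType) (K : {set {set W}}) (N : nat)
    (p : {ffun W -> 'I_N.+1}) : bool :=
  (\sum_w p w == N) && ([set w | p w != 0 :> nat] \in K).

Definition grid (W : finType) (K : {set {set W}}) (N : nat) : finType :=
  {p : {ffun W -> 'I_N.+1} | grid_point K p}.

Section Grid.
Variables (W : finType) (K : {set {set W}}) (N : nat).
Hypotheses (surfK : surface_complex K) (N_gt0 : (0 < N)%N).
Local Notation grid := (grid K N).
Implicit Types (p q r : grid) (a b c : W).

Definition gcoord p w : nat := val p w.
Definition gsupp p : {set W} := [set w | gcoord p w != 0].
Definition gnear p q : bool :=
  [forall w, (gcoord p w <= (gcoord q w).+1) && (gcoord q w <= (gcoord p w).+1)].

(** Pairwise nearness inside one simplex of [K] captures the upward and the downward small triangles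
    at once; [face_formP] separates them again. *)
Definition grid_faces : {set {set grid}} :=
  [set f : {set grid} | [&& #|f| == 3, [forall p in f, forall q in f, gnear p q] &
     \bigcup_(p in f) gsupp p \in K]].

Definition grid_adj p q : bool := [&& p != q, gnear p q & gsupp p :|: gsupp q \in K].

Lemma complex_sub (A B : {set W}) : A \in K -> B \subset A -> B != set0 -> B \in K.
Proof. by case: surfK => -[_ + _ _ _ _]; exact. Qed.

Lemma complex_pure A : A \in K -> exists2 B, B \in K & A \subset B /\ #|B| = 3.
Proof. by case: surfK => _ + _ _ _; exact. Qed.

Lemma complex_le3 A : A \in K -> #|A| <= 3.
Proof. by case: surfK => _ _ + _ _; exact. Qed.

Lemma complex_link a b : a != b -> [set a; b] \in K -> #|[set z | link_adj K a b z]| = 2.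
Proof. by case: surfK => _ _ _ + _; exact. Qed.

Lemma link_adjE a b z : link_adj K a b z = ([set a; b; z] \in K) && (#|[set a; b; z]| == 3).
Proof. by rewrite /link_adj setUA. Qed.

Lemma card3 (T : finType) (x y z : T) : (#|[set x; y; z]| == 3) = [&& x != y, x != z & y != z].
Proof.
rewrite setUC cardsU1 cards2 !inE negb_or ![z == _]eq_sym.
by case: (x == z); case: (y == z); case: (x == y).
Qed.

Lemma set3E (A : {set W}) a b c : #|A| <= 3 -> a \in A -> b \in A -> c \in A ->
  a != b -> a != c -> b != c -> A = [set a; b; c].
Proof.
move=> A3 aA bA cA ab ac bc; apply/esym/eqP; rewrite eqEcard.
have /eqP -> : #|[set a; b; c]| == 3 by rewrite card3 ab ac bc.
by rewrite A3 andbT; apply/subsetP => w; rewrite !inE => /orP[/orP[]|] /eqP->.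
Qed.

Lemma grid_ext p q : (forall w, gcoord p w = gcoord q w) -> p = q.
Proof. by move=> E; apply/val_inj/ffunP => w; apply/val_inj/E. Qed.

Lemma grid_sum p : \sum_w gcoord p w = N.
Proof. by have /andP[/eqP] := valP p. Qed.

Lemma gsupp_in p : gsupp p \in K.
Proof. by have /andP[_] := valP p. Qed.

Lemma grid_mk (f : W -> nat) : \sum_w f w = N -> [set w | f w != 0] \in K ->
  exists p, forall w, gcoord p w = f w.
Proof.
move=> fN fK; have fle w : f w < N.+1 by rewrite ltnS -fN (bigD1 w) //= leq_addr.
have vP : grid_point K [ffun w => Ordinal (fle w)].
  apply/andP; split; first by apply/eqP; under eq_bigr do rewrite ffunE.
  by under eq_finset do rewrite ffunE.
by exists (@exist _ (fun x : {ffun W -> 'I_N.+1} => grid_point K x : Prop) _ vP) => w; rewrite /gcoord /= ffunE.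
Qed.

Lemma sum3 (f : W -> nat) a b c : a != b -> a != c -> b != c ->
  (forall w, w \notin [set a; b; c] -> f w = 0) -> \sum_w f w = f a + f b + f c.
Proof.
move=> ab ac bc f0.
rewrite (bigD1 a) //= (bigD1 b) ?(eq_sym b) //= (bigD1 c) ?(eq_sym c) ?ac //=.
rewrite big1 ?addn0 ?addnA // => w /andP[/andP[wa wb] wc]; apply: f0.
by rewrite !inE !negb_or wa wb.
Qed.

Lemma grid_sum3 p a b c : a != b -> a != c -> b != c -> gsupp p \subset [set a; b; c] ->
  gcoord p a + gcoord p b + gcoord p c = N.
Proof.
move=> ab ac bc sp; rewrite -(grid_sum p) (sum3 ab ac bc) // => w.
by apply: contraNeq => w0; apply: (subsetP sp); rewrite inE.
Qed.

Lemma grid_sum2 p a b : a != b -> gsupp p \subset [set a; b] -> gcoord p a + gcoord p b = N.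
Proof.
move=> ab sp; rewrite -(grid_sum p) (bigD1 a) //= (bigD1 b) ?(eq_sym b) //=.
rewrite big1 ?addn0 // => w /andP[wa wb]; apply/eqP; apply: contraT => w0.
have : w \in gsupp p by rewrite inE.
by move/(subsetP sp); rewrite !inE (negPf wa) (negPf wb).
Qed.

Lemma grid_mk3 a b c i j l : a != b -> a != c -> b != c -> [set a; b; c] \in K ->
    i + j + l = N ->
  exists p, [/\ gcoord p a = i, gcoord p b = j, gcoord p c = l &
    gsupp p \subset [set a; b; c]].
Proof.
move=> ab ac bc abcK ijl.
pose f w := if w == a then i else if w == b then j else if w == c then l else 0.
have fa : f a = i by rewrite /f eqxx.
have fb : f b = j by rewrite /f eq_sym (negPf ab) eqxx.
have fc : f c = l by rewrite /f eq_sym (negPf ac) eq_sym (negPf bc) eqxx.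
have f0 w : w \notin [set a; b; c] -> f w = 0.
  by rewrite !inE !negb_or /f => /andP[/andP[/negPf-> /negPf->] /negPf->].
have fsub : [set w | f w != 0] \subset [set a; b; c].
  by apply/subsetP => w; rewrite inE; apply: contraR => /f0 ->.
have fN : \sum_w f w = N by rewrite (sum3 ab ac bc f0) fa fb fc.
have [||p pf] := @grid_mk f => //.
  apply: complex_sub abcK fsub _; apply: contraTneq N_gt0 => f00.
  rewrite -fN -leqNgt big1 // => w _; apply/eqP; apply: contraT => fw.
  have : w \in [set w | f w != 0] by rewrite inE.
  by rewrite f00 inE.
exists p; rewrite !pf; split=> //.
by apply/subsetP => w; rewrite inE pf => fw; apply: (subsetP fsub); rewrite inE.
Qed.

Lemma gcoord0 p (A : {set W}) w : gsupp p \subset A -> w \notin A -> gcoord p w = 0.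
Proof.
by move=> sp wA; apply/eqP; apply: contraNT wA => w0; apply: (subsetP sp); rewrite inE.
Qed.

Lemma grid_ext3 p q a b c : gsupp p \subset [set a; b; c] -> gsupp q \subset [set a; b; c] ->
  gcoord p a = gcoord q a -> gcoord p b = gcoord q b -> gcoord p c = gcoord q c -> p = q.
Proof.
move=> sp sq ea eb ec; apply: grid_ext => w.
have [|nw] := boolP (w \in [set a; b; c]); last by rewrite !(gcoord0 _ nw).
by rewrite !inE => /orP[/orP[]|]/eqP->.
Qed.

Lemma nearP p q : reflect
  (forall w, gcoord p w <= (gcoord q w).+1 /\ gcoord q w <= (gcoord p w).+1) (gnear p q).
Proof. by apply: (iffP forallP) => H w; apply/andP. Qed.

Lemma gnear_sym p q : gnear p q = gnear q p.
Proof. by apply: eq_forallb => w; rewrite andbC. Qed.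

Lemma gnear_refl p : gnear p p.
Proof. by apply/nearP. Qed.

Lemma near3 p q a b c : gsupp p \subset [set a; b; c] -> gsupp q \subset [set a; b; c] ->
  (forall w, w \in [set a; b; c] ->
     gcoord p w <= (gcoord q w).+1 /\ gcoord q w <= (gcoord p w).+1) -> gnear p q.
Proof.
move=> sp sq H; apply/nearP => w; have [/H//|nw] := boolP (w \in [set a; b; c]).
by rewrite !(gcoord0 _ nw).
Qed.

Lemma grid_lt p q : p != q -> exists a, gcoord q a < gcoord p a.
Proof.
move=> pq; apply/existsP; apply: contraNT pq => /existsPn H; apply/eqP/grid_ext.
have le w : gcoord p w <= gcoord q w by rewrite leqNgt H.
have : \sum_w (gcoord q w - gcoord p w) == 0 by rewrite sumnB // !grid_sum subnn.
rewrite sum_nat_eq0 => /forallP H0 w; have /= /eqP := H0 w; have := le w; nat_lia.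
Qed.

(** The difference of two adjacent points has entries in [{-1, 0, 1}], sum 0 and at most three
    nonzero entries: one unit moves from [a] to [b]. *)
Lemma grid_adj_coords p q : grid_adj p q -> exists a b,
  [/\ a != b, gcoord p a = (gcoord q a).+1, gcoord q b = (gcoord p b).+1 &
      forall w, w != a -> w != b -> gcoord p w = gcoord q w].
Proof.
move=> /and3P[pq /nearP pqn UK].
have [a qa] := grid_lt pq; have [b pb] : exists b, gcoord p b < gcoord q b.
  by apply: grid_lt; rewrite eq_sym.
have ab : a != b by apply: contraTneq qa => ->; rewrite -leqNgt ltnW.
exists a, b; split=> //; first by have := pqn a; nat_lia.
  by have := pqn b; nat_lia.
move=> w wa wb; have [//|pw] := eqVneq (gcoord p w) (gcoord q w).
have inU x : gcoord p x != gcoord q x -> x \in gsupp p :|: gsupp q by rewrite !inE; nat_lia.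
have UE := set3E (complex_le3 UK) (inU _ _) (inU _ _) (inU _ pw) ab.
have {}UE : gsupp p :|: gsupp q = [set a; b; w].
  by apply: UE; rewrite 1?eq_sym //; nat_lia.
have sp : gsupp p \subset [set a; b; w] by rewrite -UE subsetUl.
have sq : gsupp q \subset [set a; b; w] by rewrite -UE subsetUr.
have := grid_sum3 ab _ _ sp; have := grid_sum3 ab _ _ sq.
rewrite ![_ == w]eq_sym wa wb => /(_ isT isT) + /(_ isT isT).
have := pqn a; have := pqn b; have := pqn w; move: pw; nat_lia.
Qed.

Definition third p q r : bool :=
  [&& r != p, r != q, gnear p r, gnear q r & gsupp p :|: gsupp q :|: gsupp r \in K].

(** With unit vectors, [q = p - e_a + e_b], and the third corner is either [p - e_a + e_c] or
    [p + e_b - e_c]. *)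
Lemma third_coords p q r a b :
    a != b -> gcoord p a = (gcoord q a).+1 -> gcoord q b = (gcoord p b).+1 ->
    (forall w, w != a -> w != b -> gcoord p w = gcoord q w) ->
    third p q r ->
  exists c, [/\ c != a, c != b, gsupp p :|: gsupp q :|: gsupp r = [set a; b; c] &
    [/\ gcoord r c = (gcoord p c).+1, gcoord r a = gcoord q a & gcoord r b = gcoord p b] \/
    [/\ gcoord p c = (gcoord r c).+1, gcoord r a = gcoord p a & gcoord r b = gcoord q b]].
Proof.
move=> ab pqa pqb pqw /and5P[rp rq /nearP pr /nearP qr UK].
set U := _ :|: gsupp r in UK *.
have sp : gsupp p \subset U by rewrite /U -setUA subsetUl.
have sq : gsupp q \subset U by rewrite /U setUAC subsetUr.
have sr : gsupp r \subset U by rewrite subsetUr.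
have aU : a \in U by apply: (subsetP sp); rewrite inE pqa.
have bU : b \in U by apply: (subsetP sq); rewrite inE pqb.
have rpE : ~ (gcoord r a = gcoord p a /\ gcoord r b = gcoord p b /\
    forall w, w != a -> w != b -> gcoord r w = gcoord p w).
  case=> ea [eb ew]; move/eqP: rp; apply; apply: grid_ext => w.
  by have [->//|wa] := eqVneq w a; have [->//|wb] := eqVneq w b; exact: ew.
have rqE : ~ (gcoord r a = gcoord q a /\ gcoord r b = gcoord q b /\
    forall w, w != a -> w != b -> gcoord r w = gcoord q w).
  case=> ea [eb ew]; move/eqP: rq; apply; apply: grid_ext => w.
  by have [->//|wa] := eqVneq w a; have [->//|wb] := eqVneq w b; exact: ew.
have [c /and3P[cU ca cb]|no] := pickP (fun c => [&& c \in U, c != a & c != b]); last first.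
  have Uab : U \subset [set a; b].
    by apply/subsetP => w wU; have := no w; rewrite /= wU /= in_set2; do 2!case: eqP.
  have Up := grid_sum2 ab (subset_trans sp Uab).
  have Uq := grid_sum2 ab (subset_trans sq Uab).
  have Ur := grid_sum2 ab (subset_trans sr Uab).
  have w0 x w : gsupp x \subset U -> w != a -> w != b -> gcoord x w = 0.
    move=> sx wa wb; apply: gcoord0 (subset_trans sx Uab) _.
    by rewrite !inE negb_or wa.
  exfalso; have [ra|ra] := eqVneq (gcoord r a) (gcoord p a).
    apply: rpE; split=> //; split=> [|w wa wb]; last by rewrite !w0.
    by move: ra Up Ur; nat_lia.
  have ra' : gcoord r a = gcoord q a.
    by move: (pr a) (qr a) ra pqa; nat_lia.
  apply: rqE; split=> //; split=> [|w wa wb]; last by rewrite !w0.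
  by move: ra' Uq Ur; nat_lia.
clear rpE rqE.
have UE : U = [set a; b; c] by apply: set3E => //; rewrite ?complex_le3 // eq_sym.
exists c; split=> //.
rewrite eq_sym in ca; rewrite eq_sym in cb; rewrite UE in sp sq sr.
have Sp := grid_sum3 ab ca cb sp; have Sq := grid_sum3 ab ca cb sq.
have Sr := grid_sum3 ab ca cb sr.
have np : ~ (gcoord r a = gcoord p a /\ gcoord r b = gcoord p b).
  case=> ea eb; move/eqP: rp; apply; apply: (grid_ext3 sr sp ea eb).
  by move: ea eb Sp Sr; nat_lia.
have nq : ~ (gcoord r a = gcoord q a /\ gcoord r b = gcoord q b).
  case=> ea eb; move/eqP: rq; apply; apply: (grid_ext3 sr sq ea eb).
  by move: ea eb Sq Sr; nat_lia.
move: (pr a) (qr a) (pr b) (qr b) np nq pqa pqb Sp Sq Sr (pqw c).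
rewrite ![c == _]eq_sym ca cb => + + + + + + + + + + + /(_ isT isT); clear.
have [ra|ra] := eqVneq (gcoord r a) (gcoord p a).
  by move=> *; right; split; nat_lia.
by move=> *; left; split; nat_lia.
Qed.

(** If [p] has a positive third coordinate [c], the segment is interior to a triangle of [K] and
    both positions of [third_coords] occur, for this [c] only. Otherwise it lies on the edge [a b]
    of [K]; only the first position is possible, once for each of the two vertices in the link of
    that edge. *)
Lemma two_thirds p q : grid_adj p q -> exists r1 r2,
  r1 != r2 /\ forall r, third p q r = (r == r1) || (r == r2).
Proof.
move=> pq; have [a [b [ab pqa pqb pqw]]] := grid_adj_coords pq.
have /and3P[_ /nearP pqn UK] := pq.
have aU : a \in gsupp p :|: gsupp q by rewrite !inE pqa.
have bU : b \in gsupp p :|: gsupp q by rewrite !inE pqb orbT.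
have [c /and3P[ca cb pc]|no] := pickP (fun c => [&& c != a, c != b & gcoord p c != 0]).
  rewrite eq_sym in ca; rewrite eq_sym in cb.
  have qc : gcoord p c = gcoord q c by apply: pqw; rewrite eq_sym.
  have cU : c \in gsupp p :|: gsupp q by rewrite !inE pc.
  have UE : gsupp p :|: gsupp q = [set a; b; c] by apply: set3E => //; exact: complex_le3.
  have sp : gsupp p \subset [set a; b; c] by rewrite -UE subsetUl.
  have sq : gsupp q \subset [set a; b; c] by rewrite -UE subsetUr.
  have Sp := grid_sum3 ab ca cb sp; have Sq := grid_sum3 ab ca cb sq.
  rewrite UE in UK.
  have [|r1 [r1a r1b r1c s1]] := @grid_mk3 a b c (gcoord q a) (gcoord p b) (gcoord p c).+1 ab ca cb UK.
    by nat_lia.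
  have [|r2 [r2a r2b r2c s2]] := @grid_mk3 a b c (gcoord p a) (gcoord q b) (gcoord p c).-1 ab ca cb UK.
    by move: pc; nat_lia.
  exists r1, r2; split; first by apply/eqP => E; move: r2a; rewrite -E; nat_lia.
  have thr r : gsupp r \subset [set a; b; c] ->
     (gcoord r a, gcoord r b, gcoord r c) = (gcoord q a, gcoord p b, (gcoord p c).+1) \/
     (gcoord r a, gcoord r b, gcoord r c) = (gcoord p a, gcoord q b, (gcoord p c).-1) ->
     third p q r.
    move=> sr rE; apply/and5P; split.
    - by apply/eqP => E; rewrite E in rE; case: rE => -[]; move: pc; nat_lia.
    - by apply/eqP => E; rewrite E in rE; case: rE => -[]; move: pc; nat_lia.
    - apply: near3 sp sr _ => w; rewrite !inE => /orP[/orP[]|]/eqP->; case: rE => -[]; nat_lia.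
    - apply: near3 sq sr _ => w; rewrite !inE => /orP[/orP[]|]/eqP->; case: rE => -[]; nat_lia.
    - by rewrite UE (setUidPl sr).
  move=> r; apply/idP/orP => [tr|[]/eqP->]; last 2 first.
  - by apply: thr => //; left; rewrite r1a r1b r1c.
  - by apply: thr => //; right; rewrite r2a r2b r2c.
  have [c' [c'a c'b U'E rE]] := third_coords ab pqa pqb pqw tr.
  have cc' : c = c'.
    have : c \in [set a; b; c'] by rewrite -U'E UE !inE eqxx orbT.
    by rewrite !inE ![c == _]eq_sym (negPf ca) (negPf cb) => /eqP.
  rewrite -cc' in U'E rE.
  have sr : gsupp r \subset [set a; b; c] by rewrite -U'E subsetUr.
  by case: rE => -[rc ra rb]; [left|right]; apply/eqP; apply: grid_ext3 sr _ _ _ _ => //; nat_lia.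
have p0 w : w != a -> w != b -> gcoord p w = 0.
  by move=> wa wb; have := no w; rewrite wa wb /= => /negbFE/eqP.
have q0 w : w != a -> w != b -> gcoord q w = 0 by move=> wa wb; rewrite -pqw // p0.
have UE : gsupp p :|: gsupp q = [set a; b].
  apply/setP => w; rewrite !inE.
  have [->|wa] := eqVneq w a; first by rewrite pqa.
  have [->|wb] := eqVneq w b; first by rewrite pqb !orbT.
  by rewrite p0 // q0.
have abK : [set a; b] \in K by rewrite -UE.
have sp : gsupp p \subset [set a; b] by rewrite -UE subsetUl.
have sq : gsupp q \subset [set a; b] by rewrite -UE subsetUr.
have Sp := grid_sum2 ab sp; have Sq := grid_sum2 ab sq.
have /eqP/cards2P[z1 [z2 [z12 ZE]]] := complex_link ab abK.
have zP z : z \in [set z1; z2] -> exists r,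
    [/\ [set a; b; z] \in K, a != z, b != z, third p q r & [/\ gcoord r a = gcoord q a,
      gcoord r b = gcoord p b, gcoord r z = 1 & gsupp r \subset [set a; b; z]]].
  rewrite -ZE inE link_adjE card3 => /andP[abzK /and3P[_ az bz]].
  have [|r [ra rb rz sr]] := @grid_mk3 a b z (gcoord q a) (gcoord p b) 1 ab az bz abzK; first by nat_lia.
  have sub : [set a; b] \subset [set a; b; z] by apply: subsetUl.
  have sp' := subset_trans sp sub; have sq' := subset_trans sq sub.
  have pz : gcoord p z = 0 by apply: p0; rewrite eq_sym.
  have qz : gcoord q z = 0 by apply: q0; rewrite eq_sym.
  exists r; split=> //; apply/and5P; split.
  - by apply/eqP => E; move: rz; rewrite E pz.
  - by apply/eqP => E; move: rz; rewrite E qz.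
  - by apply: near3 sp' sr _ => w; rewrite !inE => /orP[/orP[]|]/eqP->; nat_lia.
  - by apply: near3 sq' sr _ => w; rewrite !inE => /orP[/orP[]|]/eqP->; nat_lia.
  - rewrite UE; apply: complex_sub abzK _ _; first by rewrite subUset sub.
    by apply/set0Pn; exists a; rewrite !inE eqxx.
have [r1 [_ az1 bz1 t1 [r1a r1b r1z s1]]] := zP z1 (set21 _ _).
have [r2 [_ az2 bz2 t2 [r2a r2b r2z s2']]] := zP z2 (set22 _ _).
exists r1, r2; split.
  apply/eqP => E; rewrite -E in s2' r2z; have : z2 \in [set a; b; z1].
    by apply: (subsetP s1); rewrite inE r2z.
  by rewrite !inE ![z2 == _]eq_sym (negPf az2) (negPf bz2) (negPf z12).
move=> r; apply/idP/orP => [tr|[]/eqP->//].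
have [c [ca cb U'E rE]] := third_coords ab pqa pqb pqw tr.
have pc := p0 _ ca cb.
have sr : gsupp r \subset [set a; b; c] by rewrite -U'E subsetUr.
have : c \in [set z1; z2].
  rewrite -ZE inE link_adjE card3 -U'E ab ![_ == c]eq_sym ca cb.
  by have /and5P[_ _ _ _ ->] := tr.
rewrite !inE => /orP[]/eqP cz; [left|right]; apply/eqP; rewrite cz in sr rE pc;
  by apply: grid_ext3 sr _ _ _ _ => //; case: rE => -[]; nat_lia.
Qed.

Lemma bigcup_set3 (p q r : grid) :
  \bigcup_(x in [set p; q; r]) gsupp x = gsupp p :|: gsupp q :|: gsupp r.
Proof. by rewrite !bigcup_setU !big_set1. Qed.

Lemma grid_face_mk p q r : grid_adj p q -> third p q r -> [set p; q; r] \in grid_faces.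
Proof.
move=> /and3P[pq npq _] /and5P[rp rq npr nqr UK].
rewrite inE card3 pq ![_ == r]eq_sym rp rq bigcup_set3 UK /= andbT.
apply/forall_inP => x; rewrite !inE => /orP[/orP[]|]/eqP->; apply/forall_inP => y;
  rewrite !inE => /orP[/orP[]|]/eqP->; rewrite ?gnear_refl //; by rewrite gnear_sym.
Qed.

Lemma grid_face3 f p q : f \in grid_faces -> p \in f -> q \in f -> p != q ->
  grid_adj p q /\ exists2 r, f = [set p; q; r] & third p q r.
Proof.
rewrite inE => /and3P[/eqP f3 /forall_inP nr UK] pf qf pq.
have npq x y : x \in f -> y \in f -> gnear x y.
  by move=> xf yf; have /forall_inP := nr x xf; apply.
have [r /and3P[rf rp rq]] : exists r, [&& r \in f, r != p & r != q].
  apply/existsP; apply: contraT => /existsPn no.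
  have : f \subset [set p; q].
    apply/subsetP => x xf; have := no x; rewrite xf !inE.
    by case: (x == p); case: (x == q).
  by move/subset_leq_card; rewrite f3 cards2 pq.
have fE : f = [set p; q; r].
  apply/esym/eqP; rewrite eqEcard f3.
  have /eqP -> : #|[set p; q; r]| == 3 by rewrite card3 pq ![_ == r]eq_sym rp.
  by rewrite andbT; apply/subsetP => w; rewrite !inE => /orP[/orP[]|] /eqP->.
rewrite fE bigcup_set3 in UK.
split; last by exists r => //; rewrite /third rp rq !npq.
rewrite /grid_adj pq npq //=; apply: complex_sub UK (subsetUl _ _) _.
apply: contraTneq (gsupp_in p) => U0.
have -> : gsupp p = set0 by apply/eqP; rewrite -subset0 -U0 subsetUl.
by case: surfK => -[].
Qed.

Lemma grid_face_adjE p q : face_adj grid_faces p q = grid_adj p q.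
Proof.
rewrite /face_adj inE cards2; apply/andP/idP => [[pq /existsP[f /andP[fF sf]]]|pq].
  have pq' : p != q by case: (p != q) pq.
  by have [] := grid_face3 fF (subsetP sf p (set21 _ _)) (subsetP sf q (set22 _ _)) pq'.
have /and3P[pq' _ _] := pq; rewrite pq'; split=> //.
have [r1 [r2 [_ r12]]] := two_thirds pq; have t1 : third p q r1 by rewrite r12 eqxx.
by apply/existsP; exists [set p; q; r1]; rewrite grid_face_mk // subsetUl.
Qed.

Lemma grid_pseudosurface : pseudosurface grid_faces.
Proof.
split=> [f|E EF]; first by rewrite inE => /and3P[/eqP].
have : #|E| == 2 by move: EF; rewrite inE => /andP[].
move=> /cards2P[p [q [pq EE]]]; rewrite EE in EF *.
have pqa : grid_adj p q by rewrite -grid_face_adjE.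
have [r1 [r2 [r12 thE]]] := two_thirds pqa.
have t1 : third p q r1 by rewrite thE eqxx.
have t2 : third p q r2 by rewrite thE eqxx orbT.
suff -> : [set f in grid_faces | [set p; q] \subset f] = [set [set p; q; r1]; [set p; q; r2]].
  rewrite cards2; suff -> : [set p; q; r1] != [set p; q; r2] by [].
  apply/eqP => /setP/(_ r1); rewrite !inE eqxx orbT => /esym.
  by have /and5P[/negPf-> /negPf-> _ _ _] := t1; rewrite (negPf r12).
apply/setP => f; rewrite in_set in_set2; apply/andP/orP => [[fF sf]|].
  have [_ [r -> ]] := grid_face3 fF (subsetP sf p (set21 _ _)) (subsetP sf q (set22 _ _)) pq.
  by rewrite thE => /orP[]/eqP->; [left|right].
by case=> /eqP->; rewrite grid_face_mk // subsetUl.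
Qed.

(** * Vertex degrees of the subdivision *)

Definition ext_vertices (A : {set W}) : {set W} := [set z | (z \notin A) && (z |: A \in K)].

(** A neighbor is determined by the coordinate that loses a unit, taken in the support, and the
    other one that gains it, taken in the support or among the vertices extending it. For supports
    of size 2 and 3 this gives 6. *)
Lemma grid_degree p :
  #|[set q | grid_adj p q]| <= #|gsupp p| * (#|gsupp p| + #|ext_vertices (gsupp p)|) - #|gsupp p|.
Proof.
move AE : (gsupp p) => A; set Z := ext_vertices A.
pose mv (ab : W * W) : grid := odflt p [pick q : grid |
  [&& gcoord p ab.1 == (gcoord q ab.1).+1, gcoord q ab.2 == (gcoord p ab.2).+1 &
   [forall w, (w != ab.1) ==> (w != ab.2) ==> (gcoord p w == gcoord q w)]]].
pose Q := finset.setX A (A :|: Z) :\: [set (a, a) | a in A].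
have AZ : [disjoint A & Z].
  by apply/pred0P => z /=; rewrite [z \in Z]inE; case: (z \in A).
have QE : #|Q| = #|A| * (#|A| + #|Z|) - #|A|.
  rewrite cardsD cardsX cardsU disjoint_setI0 // cards0 subn0; congr (_ - _).
  rewrite (setIidPr _) ?card_imset //; first by move=> a b [].
  by apply/subsetP => _ /imsetP[a aA ->]; rewrite in_setX in_setU aA.
rewrite -QE; apply: leq_trans (leq_imset_card mv Q); apply: subset_leq_card.
apply/subsetP => q; rewrite inE => pq; have [a [b [ab pqa pqb pqw]]] := grid_adj_coords pq.
apply/imsetP; exists (a, b).
  have aA : a \in A by rewrite -AE inE pqa.
  rewrite in_setD in_setX aA; apply/andP; split.
    by apply: contraNN ab => /imsetP[x _ [-> ->]].
  rewrite in_setU; case: (boolP (b \in A)) => //= bA; rewrite inE bA.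
  have /and3P[_ _ UK] := pq; apply: complex_sub UK _ _.
    by rewrite -AE subUset sub1set subsetUl !inE pqb orbT.
  by apply/set0Pn; exists b; rewrite !inE eqxx.
rewrite /mv; case: pickP => [q' /and3P[/eqP /= e1 /eqP e2 /forallP e3]|/(_ q)].
  apply: grid_ext => w; have [->|wa] := eqVneq w a; first by move: e1 pqa; nat_lia.
  have [->|wb] := eqVneq w b; first by move: e2 pqb; nat_lia.
  by have := e3 w; rewrite wa wb /= -pqw // => /eqP.
rewrite /= pqa pqb !eqxx /= => /negbT/negP; case.
by apply/forallP => w; apply/implyP => wa; apply/implyP => wb; rewrite pqw.
Qed.

Lemma ext_vertices2 (A : {set W}) : A \in K -> #|A| = 2 -> #|ext_vertices A| = 2.
Proof.
move=> + /eqP/cards2P[x [y [xy AE]]]; rewrite {A}AE => AK.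
rewrite -(complex_link xy AK); apply: eq_card => z.
rewrite !inE link_adjE card3 xy negb_or ![z == _]eq_sym andbC /=.
by rewrite [z |: _]setUC.
Qed.

Lemma ext_vertices3 (A : {set W}) : A \in K -> #|A| = 3 -> #|ext_vertices A| = 0.
Proof.
move=> AK A3; apply: eq_card0 => z; rewrite inE; apply/negP => /andP[zA /complex_le3].
by rewrite cardsU1 zA A3.
Qed.

Definition faces_of_dim (K' : {set {set W}}) n := [set A in K' | #|A| == n].

Lemma grid_corner_imset :
  gsupp @: [set p | #|gsupp p| == 1] = faces_of_dim K 1.
Proof.
apply/setP => A; apply/imsetP/idP => [[p]|].
  by rewrite inE => p1 ->; rewrite inE gsupp_in p1.
rewrite inE => /andP[AK /cards1P[x AE]].
have N0 : (N != 0) by rewrite -lt0n.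
have [||p pE] := @grid_mk (fun w => if w == x then N else 0).
- by rewrite -big_mkcond /= big_pred1_eq.
- suff -> : [set w | (if w == x then N else 0) != 0] = A by [].
  by apply/setP => w; rewrite AE !inE; case: (w == x); rewrite ?N0.
have sE : gsupp p = A by apply/setP => w; rewrite AE !inE pE; case: (w == x); rewrite ?N0.
by exists p; rewrite // inE sE AE cards1.
Qed.

Lemma grid_corner_inj : {in [set p | #|gsupp p| == 1] &, injective gsupp}.
Proof.
move=> p q; rewrite !inE => /cards1P[x px] _ pq; have qx : gsupp q = [set x] by rewrite -pq.
have val1 r w : gsupp r = [set x] -> gcoord r w = if w == x then N else 0.
  move=> rx; have r0 v : v != x -> gcoord r v = 0.
    by move=> vx; apply: (@gcoord0 r [set x]); rewrite ?rx // inE.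
  by case: eqP => [->|/eqP/r0//]; rewrite -(grid_sum r) (bigD1 x) //= big1 ?addn0 //.
by apply: grid_ext => w; rewrite (val1 p w px) (val1 q w qx).
Qed.

(* Combinatorial Gauss-Bonnet: the grid is 6-regular except at the vertices of [K]. *)
Lemma grid_euler :
  2 * #|face_edges grid_faces| + 6 * #|faces_of_dim K 1|
    <= 6 * #|{: grid}| + 2 * #|faces_of_dim K 2|.
Proof.
rewrite -(handshake (E := face_edges grid_faces)); last by move=> E; rewrite inE => /andP[/eqP].
rewrite -(handshake (E := faces_of_dim K 2)); last by move=> E; rewrite inE => /andP[_ /eqP].
have -> : 6 * #|faces_of_dim K 1| = \sum_(p | #|gsupp p| == 1) 6.
  rewrite -grid_corner_imset (card_in_imset grid_corner_inj) mulnC -sum_nat_const.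
  by apply: eq_bigl => p; rewrite inE.
(* The neighbors of a corner correspond to those of the vertex in [K], so the corners contribute at
   most twice the number of edges of [K]. *)
have corner : \sum_(p | #|gsupp p| == 1) #|ext_vertices (gsupp p)|
    <= \sum_x #|[set y | [set x; y] \in faces_of_dim K 2]|.
  have -> : \sum_(p | #|gsupp p| == 1) #|ext_vertices (gsupp p)| =
      \sum_(A in faces_of_dim K 1) #|ext_vertices A|.
    rewrite -grid_corner_imset (big_imset _ grid_corner_inj) /=.
    by apply: eq_bigl => p; rewrite inE.
  apply: (@leq_trans (\sum_(A in [set [set x] | x in W]) #|ext_vertices A|)).
    rewrite [leqRHS](bigID (mem (faces_of_dim K 1))) /=; apply: leq_trans (leq_addr _ _).
    apply: eq_leq; apply: eq_bigl => A; rewrite andbC andb_idr //.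
    by rewrite inE => /andP[_ /cards1P[x ->]]; apply: imset_f.
  rewrite big_imset /=; last by move=> x y _ _; apply: set1_inj.
  apply: leq_sum => x _; apply: subset_leq_card; apply/subsetP => y.
  rewrite !inE => /andP[yx]; rewrite setUC => ->; by rewrite cards2 (eq_sym x) yx.
apply: leq_trans (leq_add (leqnn (6 * _)) corner).
rewrite mulnC -sum_nat_const (bigID (fun p => #|gsupp p| == 1)) /=.
rewrite [X in _ <= X + _](bigID (fun p => #|gsupp p| == 1)) /=.
suff [le1 le2] : (forall p, #|gsupp p| == 1 ->
      #|[set q | face_adj grid_faces p q]| <= #|ext_vertices (gsupp p)|) /\
    (forall p, #|gsupp p| != 1 -> #|[set q | face_adj grid_faces p q]| <= 6).
  rewrite addnAC -[leqRHS]addnA [X in _ <= _ + X]addnC addnA [X in _ <= X + _]addnC.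
  by apply: leq_add; [apply: leq_add => //|]; apply: leq_sum => p; [exact: le1|exact: le2].
have degE p : #|[set q | face_adj grid_faces p q]| = #|[set q | grid_adj p q]|.
  by apply: eq_card => q; rewrite !inE grid_face_adjE.
split=> p; rewrite degE.
  by move=> /eqP p1; apply: leq_trans (grid_degree p) _; rewrite p1; nat_lia.
move=> p1; apply: leq_trans (grid_degree p) _.
have := complex_le3 (gsupp_in p); have : #|gsupp p| != 0.
  rewrite cards_eq0; apply: contraTneq (gsupp_in p) => ->; by case: surfK => -[].
have := ext_vertices2 (gsupp_in p); have := ext_vertices3 (gsupp_in p).
move: p1; case: #|gsupp p| => [|[|[|[|n]]]] //.
  by move=> _ _ /(_ erefl) ->.
by move=> _ /(_ erefl) ->.
Qed.

(** * Connectedness of the small triangles across edges *)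

Lemma complex_pseudosurface : pseudosurface (faces_of_dim K 3) /\
  face_edges (faces_of_dim K 3) = faces_of_dim K 2.
Proof.
have FE : face_edges (faces_of_dim K 3) = faces_of_dim K 2.
  apply/setP => E; rewrite !inE andbC; apply/andP/andP => -[EK E2]; split=> //.
    have /existsP[f] := EK; rewrite inE => /andP[/andP[fK _] sf].
    by apply: complex_sub fK sf _; rewrite -cards_eq0 (eqP E2).
  have [B BK [EB B3]] := complex_pure EK.
  by apply/existsP; exists B; rewrite inE BK B3 EB.
split=> //; split=> [f|E]; first by rewrite inE => /andP[_ /eqP].
rewrite FE inE => /andP[EK E2]; have /cards2P[a [b [ab EE]]] := E2.
rewrite EE in EK *; rewrite -[RHS](complex_link ab EK).
rewrite -[RHS](card_in_imset (f := fun z => [set a; b; z])); last first.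
  move=> y z; rewrite !inE !link_adjE !card3 => /and4P[_ _ ay yb] _ /setP/(_ y).
  by rewrite !inE eqxx orbT ![y == _]eq_sym (negPf ay) (negPf yb) eq_sym => /esym/eqP.
apply: eq_card => f; rewrite in_set; apply/andP/imsetP => [[]|[z]].
  rewrite inE => /andP[fK /eqP f3] sf.
  have [z /and3P[zf za zb]] : exists z, [&& z \in f, z != a & z != b].
    apply/existsP; apply: contraT => /existsPn no.
    have : f \subset [set a; b].
      apply/subsetP => x xf; have := no x; rewrite xf !inE.
      by case: (x == a); case: (x == b).
    by move/subset_leq_card; rewrite f3 cards2 ab.
  have fE : f = [set a; b; z].
    have af : a \in f by apply: (subsetP sf); rewrite set21.
    have bf : b \in f by apply: (subsetP sf); rewrite set22.
    by apply: set3E; rewrite ?f3 // eq_sym.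
  by exists z; rewrite // inE link_adjE -fE fK f3.
rewrite inE link_adjE => /andP[zK z3] ->; split; last exact: subsetUl.
by rewrite inE zK z3.
Qed.

Lemma inter_card2 (T : finType) (A B : {set T}) x y : #|A| = 3 -> #|B| = 3 -> x != y ->
  x \in A -> y \in A -> x \in B -> y \in B -> A = B \/ #|A :&: B| = 2.
Proof.
move=> A3 B3 xy xA yA xB yB; have [->|AB] := eqVneq A B; [by left|right].
apply/eqP; rewrite eqn_leq; apply/andP; split.
  rewrite -ltnS -A3; apply: proper_card; rewrite properE subsetIl /=.
  apply: contra AB; rewrite subsetI subxx /= => AB.
  by rewrite eqEcard AB A3 B3.
have <- : #|[set x; y]| = 2 by rewrite cards2 xy.
apply: subset_leq_card; apply/subsetP => w; rewrite !inE.
by case/orP => /eqP->; apply/andP.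
Qed.

(** The link of [v] is connected, and a walk in it crosses, one after the other, edges of [K]
    through [v]. *)
Lemma link_closed (S : {set {set W}}) A B v :
    (forall A B, A \in S -> B \in faces_of_dim K 3 -> #|A :&: B| = 2 -> B \in S) ->
    A \in faces_of_dim K 3 -> A \in S -> B \in faces_of_dim K 3 -> v \in A -> v \in B ->
  B \in S.
Proof.
move=> Scl AF AS BF vA vB.
have dimP T : T \in faces_of_dim K 3 -> T \in K /\ #|T| = 3.
  by rewrite inE => /andP[? /eqP].
have other T : T \in faces_of_dim K 3 -> v \in T -> exists w, [/\ v != w, w \in T & [set v; w] \in K].
  move=> /dimP[TK T3] vT; have : #|T :\ v| = 2 by have := cardsD1 v T; rewrite vT T3 => -[].
  move=> T2; have /set0Pn[w] : T :\ v != set0 by rewrite -cards_eq0 T2.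
  rewrite !inE => /andP[wv wT]; exists w; split=> //; first by rewrite eq_sym.
  apply: complex_sub TK _ _; first by apply/subsetP => x; rewrite !inE => /orP[]/eqP->.
  by apply/set0Pn; exists v; rewrite !inE eqxx.
have [w [vw wA vwK]] := other A AF vA; have [w' [vw' wB vw'K]] := other B BF vB.
have : connect (link_adj K v) w w' by case: surfK => _ _ _ _; apply.
pose Q x := forall T, T \in faces_of_dim K 3 -> v \in T -> x \in T -> T \in S.
have share T1 T2 x : v != x -> T1 \in S -> T1 \in faces_of_dim K 3 ->
    T2 \in faces_of_dim K 3 -> v \in T1 -> x \in T1 -> v \in T2 -> x \in T2 -> T2 \in S.
  move=> vx T1S T1F T2F v1 x1 v2 x2; have [_ c1] := dimP _ T1F; have [_ c2] := dimP _ T2F.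
  have [<-//|] := inter_card2 c1 c2 vx v1 x1 v2 x2; exact: Scl.
have Qw : Q w by move=> T TF vT wT; apply: (share A T w).
move=> /connectP[s ps w'E]; suff : Q w' by apply.
rewrite w'E; elim: s w Qw {vw wA vwK w'E} ps => //= x s IH w Qw /andP[wx ps]; apply: IH ps.
move: wx; rewrite link_adjE card3 => /andP[TK /and3P[vw vx wx]].
have TF : [set v; w; x] \in faces_of_dim K 3 by rewrite inE TK card3 vw vx wx.
have TS : [set v; w; x] \in S by apply: Qw; rewrite // !inE eqxx ?orbT.
move=> T TF' vT xT.
by apply: (share [set v; w; x] T x); rewrite // !inE eqxx ?orbT.
Qed.

Definition face_supp (f : {set grid}) : {set W} := \bigcup_(p in f) gsupp p.

(* [X], [Y], [Z] are the vertices of [f] with respectively the largest (in an upward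
   triangle) or smallest (in a downward one) coordinate at [x], [y], [z]. *)
Definition face_form (f : {set grid}) x y z X Y Z : Prop :=
  [/\ f = [set X; Y; Z],
      [/\ gsupp X \subset [set x; y; z], gsupp Y \subset [set x; y; z] &
          gsupp Z \subset [set x; y; z]] &
    [/\ gcoord X x = (gcoord Y x).+1 /\ gcoord X x = (gcoord Z x).+1,
        gcoord Y y = (gcoord X y).+1 /\ gcoord Y y = (gcoord Z y).+1 &
        gcoord Z z = (gcoord X z).+1 /\ gcoord Z z = (gcoord Y z).+1] \/
    [/\ gcoord Y x = (gcoord X x).+1 /\ gcoord Z x = (gcoord X x).+1,
        gcoord X y = (gcoord Y y).+1 /\ gcoord Z y = (gcoord Y y).+1 &
        gcoord X z = (gcoord Z z).+1 /\ gcoord Y z = (gcoord Z z).+1]].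

Lemma set3_swap (T : finType) (x y z : T) : [set x; y; z] = [set y; x; z].
Proof. by rewrite [[set x; y]]setUC. Qed.

Lemma set3_rot (T : finType) (x y z : T) : [set x; y; z] = [set y; z; x].
Proof. by rewrite -setUA setUC. Qed.

Lemma face_form_swap f x y z X Y Z : face_form f x y z X Y Z -> face_form f y x z Y X Z.
Proof.
case=> -> [sX sY sZ] H; split; [exact: set3_swap|by rewrite [[set y; x; z]]set3_swap|].
by case: H => -[[? ?] [? ?] [? ?]]; [left|right].
Qed.

Lemma face_form_rot f x y z X Y Z : face_form f x y z X Y Z -> face_form f y z x Y Z X.
Proof.
case=> -> [sX sY sZ] H; split; [exact: set3_rot|by rewrite -[[set y; z; x]]set3_rot|].
by case: H => -[[? ?] [? ?] [? ?]]; [left|right].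
Qed.

Lemma face_formP f : f \in grid_faces -> exists a b c, [/\ a != b, a != c, b != c,
  face_supp f = [set a; b; c] & exists X Y Z, face_form f a b c X Y Z].
Proof.
move=> fF; have /eqP f3 : #|f| == 3 by move: (fF); rewrite inE => /and3P[].
have /card_gt1P[p [q [pf qf pq]]] : 1 < #|f| by rewrite f3.
have [pqa [r fE tr]] := grid_face3 fF pf qf pq.
have [a [b [ab pqA pqB pqw]]] := grid_adj_coords pqa.
have [c [ca cb UE rE]] := third_coords ab pqA pqB pqw tr.
have pqc := pqw _ ca cb; rewrite eq_sym in ca; rewrite eq_sym in cb.
exists a, b, c; split=> //; first by rewrite /face_supp fE bigcup_set3.
have sp : gsupp p \subset [set a; b; c] by rewrite -UE -setUA subsetUl.
have sq : gsupp q \subset [set a; b; c] by rewrite -UE setUAC subsetUr.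
have sr : gsupp r \subset [set a; b; c] by rewrite -UE subsetUr.
case: rE => -[rc ra rb].
  by exists p, q, r; split=> //; left; split; split; nat_lia.
exists q, p, r; split; [by rewrite set3_swap|by []|].
by right; split; split; nat_lia.
Qed.

Lemma face_form_exists f x y z : f \in grid_faces -> x != y -> x != z -> y != z ->
  face_supp f = [set x; y; z] -> exists X Y Z, face_form f x y z X Y Z.
Proof.
move=> /face_formP[a [b [c [ab ac bc -> [X [Y [Z F1]]]]]]] xy xz yz E.
have F2 := face_form_rot F1; have F3 := face_form_rot F2.
have G1 := face_form_swap F1; have G2 := face_form_swap F2; have G3 := face_form_swap F3.
have : x \in [set a; b; c] by rewrite E !inE eqxx.
have : y \in [set a; b; c] by rewrite E !inE eqxx orbT.
have : z \in [set a; b; c] by rewrite E !inE eqxx !orbT.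
rewrite !inE => /orP[/orP[]|]/eqP zE /orP[/orP[]|]/eqP yE /orP[/orP[]|]/eqP xE;
  move: xy xz yz; rewrite zE yE xE ?eqxx // => _ _ _;
  by [exists X, Y, Z|exists Y, Z, X|exists Z, X, Y|exists Y, X, Z|exists Z, Y, X|exists X, Z, Y].
Qed.

Lemma face_mk (A : {set W}) p q r : A \in K -> p != q -> p != r -> q != r ->
    gnear p q -> gnear p r -> gnear q r ->
    gsupp p \subset A -> gsupp q \subset A -> gsupp r \subset A ->
  [set p; q; r] \in grid_faces.
Proof.
move=> AK pq pr qr npq npr nqr sp sq sr.
have ne : gsupp p != set0.
  by apply: contraTneq (gsupp_in p) => ->; case: surfK => -[].
have UK (B : {set W}) : B \subset A -> gsupp p \subset B -> B \in K.
  move=> BA pB; apply: complex_sub AK BA _; apply: contraNneq ne => B0.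
  by rewrite -subset0 -B0.
apply: grid_face_mk.
  by rewrite /grid_adj pq npq UK ?subUset ?sp ?sq ?subsetUl.
rewrite /third ![r == _]eq_sym pr qr npr nqr UK ?subUset ?sp ?sq ?sr //.
by rewrite -setUA subsetUl.
Qed.

Lemma face_supp_eq f (A : {set W}) : f \in grid_faces -> A \in K -> face_supp f \subset A ->
  face_supp f = A.
Proof.
move=> /face_formP[a [b [c [ab ac bc -> _]]]] AK sA; apply/eqP; rewrite eqEcard sA.
have /eqP -> : #|[set a; b; c]| == 3 by rewrite card3 ab ac bc.
exact: complex_le3.
Qed.

Lemma face_supp_in f : f \in grid_faces -> face_supp f \in K.
Proof. by rewrite inE => /and3P[]. Qed.

Lemma near_set3 (x y z : W) p q : gsupp p \subset [set x; y; z] -> gsupp q \subset [set x; y; z] ->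
  gcoord p x <= (gcoord q x).+1 /\ gcoord q x <= (gcoord p x).+1 ->
  gcoord p y <= (gcoord q y).+1 /\ gcoord q y <= (gcoord p y).+1 ->
  gcoord p z <= (gcoord q z).+1 /\ gcoord q z <= (gcoord p z).+1 -> gnear p q.
Proof.
move=> sp sq hx hy hz; apply: near3 sp sq _ => w.
by rewrite !inE => /orP[/orP[]|]/eqP->.
Qed.

Lemma gcoord_neq p q w : gcoord p w != gcoord q w -> p != q.
Proof. by apply: contraNneq => ->. Qed.

Lemma face_supp_form f x y z X Y Z : f \in grid_faces -> [set x; y; z] \in K ->
  face_form f x y z X Y Z -> face_supp f = [set x; y; z].
Proof.
move=> fF xyzK [fE [sX sY sZ] _]; apply: face_supp_eq => //.
by rewrite /face_supp fE bigcup_set3 !subUset sX sY sZ.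
Qed.

(* The sum of the coordinates at [z] is a potential driving all the faces of a triangle
   to its corner [z]. *)
Lemma face_flip f x y z X Y Z : f \in grid_faces -> x != y -> x != z -> y != z ->
    [set x; y; z] \in K -> face_form f x y z X Y Z -> gcoord Z z != N ->
  exists f', [/\ f' \in grid_faces, #|f :&: f'| = 2, face_supp f' = face_supp f &
    \sum_(p in f) gcoord p z < \sum_(p in f') gcoord p z].
Proof.
move=> fF xy xz yz xyzK ff ZN.
have fs := face_supp_form fF xyzK ff; have [fE [sX sY sZ] H] := ff.
have SX := grid_sum3 xy xz yz sX; have SY := grid_sum3 xy xz yz sY.
have SZ := grid_sum3 xy xz yz sZ.
have XY : X != Y by apply: (@gcoord_neq _ _ x); case: H => -[]; nat_lia.
have XZ : X != Z by apply: (@gcoord_neq _ _ x); case: H => -[]; nat_lia.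
have YZ : Y != Z by apply: (@gcoord_neq _ _ y); case: H => -[]; nat_lia.
have YX : Y != X by rewrite eq_sym.
have ZX : Z != X by rewrite eq_sym.
have ZY : Z != Y by rewrite eq_sym.
have sum3p P1 P2 P3 : P1 != P2 -> P1 != P3 -> P2 != P3 ->
    \sum_(p in [set P1; P2; P3]) gcoord p z = gcoord P1 z + gcoord P2 z + gcoord P3 z.
  move=> n12 n13 n23; rewrite setUC big_setU1 ?big_setU1 ?big_set1 /=; first nat_lia.
    by rewrite inE.
  by rewrite !inE negb_or ![P3 == _]eq_sym n13.
have inter P1 P2 P3 P4 : P1 != P2 -> P1 != P3 -> P2 != P3 -> P4 != P3 ->
    #|[set P1; P2; P3] :&: [set P1; P2; P4]| = 2.
  move=> n12 n13 n23 n43; rewrite -setUIr.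
  suff -> : [set P3] :&: [set P4] = set0 by rewrite setU0 cards2 n12.
  by apply/setP => w; rewrite !inE; case: eqP => // ->; rewrite eq_sym (negPf n43).
have go P1 P2 P3 P4 : f = [set P1; P2; P3] -> P1 != P2 -> P1 != P3 -> P2 != P3 -> P4 != P3 ->
    P1 != P4 -> P2 != P4 -> gnear P1 P2 -> gnear P1 P4 -> gnear P2 P4 ->
    gsupp P1 \subset [set x; y; z] -> gsupp P2 \subset [set x; y; z] ->
    gsupp P4 \subset [set x; y; z] -> gcoord P3 z < gcoord P4 z ->
    exists f', [/\ f' \in grid_faces, #|f :&: f'| = 2, face_supp f' = face_supp f &
      \sum_(p in f) gcoord p z < \sum_(p in f') gcoord p z].
  move=> fE' n12 n13 n23 n43 n14 n24 N12 N14 N24 s1 s2 s4 lt.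
  have f'F := face_mk xyzK n12 n14 n24 N12 N14 N24 s1 s2 s4.
  exists [set P1; P2; P4]; split=> //; first by rewrite fE' inter.
    by rewrite fs; apply: face_supp_eq => //; rewrite /face_supp bigcup_set3 !subUset s1 s2 s4.
  by rewrite fE' !sum3p // ltn_add2l.
have mk := @grid_mk3 x y z _ _ _ xy xz yz xyzK.
case: H => -[[H1 H2] [H3 H4] [H5 H6]].
  (* Upward triangle, with corners [m + e_x], [m + e_y], [m + e_z]. As [Z] is not the corner of [K]
     at [z], [m] is positive at [x] or at [y]; a unit is taken there and the flip crosses the edge
     through [Z] facing that side. *)
  have [Zx|Zx] := posnP (gcoord Z x).
    have [|R [Rx Ry Rz sR]] := mk (gcoord Z x).+1 (gcoord Z y).-1 (gcoord Z z); first by nat_lia.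
    apply: (go X Z Y R) => //.
    - by rewrite fE setUAC.
    - by apply: (@gcoord_neq _ _ y); nat_lia.
    - by apply: (@gcoord_neq _ _ z); nat_lia.
    - by apply: (@gcoord_neq _ _ x); nat_lia.
    - by apply: (near_set3 sX sZ); nat_lia.
    - by apply: (near_set3 sX sR); nat_lia.
    - by apply: (near_set3 sZ sR); nat_lia.
    - by nat_lia.
  have [|R [Rx Ry Rz sR]] := mk (gcoord Z x).-1 (gcoord Z y).+1 (gcoord Z z); first by nat_lia.
  apply: (go Y Z X R) => //.
  - by rewrite fE; exact: set3_rot.
  - by apply: (@gcoord_neq _ _ x); nat_lia.
  - by apply: (@gcoord_neq _ _ x); nat_lia.
  - by apply: (@gcoord_neq _ _ y); nat_lia.
  - by apply: (near_set3 sY sZ); nat_lia.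
  - by apply: (near_set3 sY sR); nat_lia.
  - by apply: (near_set3 sZ sR); nat_lia.
  - by nat_lia.
(* Downward triangle: [Z] has the smallest coordinate at [z], and the flip crosses the edge
   [X Y]. *)
have [|R [Rx Ry Rz sR]] := mk (gcoord X x) (gcoord Y y) (gcoord X z).+1; first by nat_lia.
apply: (go X Y Z R) => //.
- by apply: (@gcoord_neq _ _ z); nat_lia.
- by apply: (@gcoord_neq _ _ z); nat_lia.
- by apply: (@gcoord_neq _ _ z); nat_lia.
- by apply: (near_set3 sX sY); nat_lia.
- by apply: (near_set3 sX sR); nat_lia.
- by apply: (near_set3 sY sR); nat_lia.
- by nat_lia.
Qed.

Lemma face_corner (C : {set {set grid}}) f x y z : C \subset grid_faces ->
    (forall f f', f \in C -> f' \in grid_faces -> #|f :&: f'| = 2 -> f' \in C) ->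
    f \in grid_faces -> x != y -> x != z -> y != z -> face_supp f = [set x; y; z] ->
  exists f0 X Y Z, [/\ f0 \in grid_faces, (f \in C) = (f0 \in C),
    face_form f0 x y z X Y Z & gcoord Z z = N].
Proof.
move=> CF Ccl + xy xz yz; have [n] := ubnP (#|f| * N - \sum_(p in f) gcoord p z).
elim: n f => // n IH f lt fF fs; have xyzK : [set x; y; z] \in K by rewrite -fs face_supp_in.
have [X [Y [Z ff]]] := face_form_exists fF xy xz yz fs.
have [ZN|ZN] := eqVneq (gcoord Z z) N; first by exists f, X, Y, Z.
have [f' [f'F inter fs' pot]] := face_flip fF xy xz yz xyzK ff ZN.
have card f1 : f1 \in grid_faces -> #|f1| = 3 by rewrite inE => /and3P[/eqP].
have fC : (f \in C) = (f' \in C).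
  apply/idP/idP => H; first exact: Ccl H f'F inter.
  by apply: Ccl H fF _; rewrite setIC.
rewrite fC; apply: IH => //; last by rewrite fs'.
have le : \sum_(p in f') gcoord p z <= #|f'| * N.
  by rewrite -sum_nat_const; apply: leq_sum => p _; rewrite -ltnS ltn_ord.
by move: lt le; rewrite !card // => lt le; move: lt le pot; clear; lia.
Qed.

(** Flips preserve membership in [C] and drive both faces to the corner [z], where the triangle of
    [K] contains only one small face: it is upward, as a downward one would have a coordinate
    [N + 1]. *)
Lemma face_same_supp (C : {set {set grid}}) f f' : C \subset grid_faces ->
    (forall f f', f \in C -> f' \in grid_faces -> #|f :&: f'| = 2 -> f' \in C) ->
    f \in grid_faces -> f' \in grid_faces -> face_supp f = face_supp f' ->
  (f \in C) = (f' \in C).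
Proof.
move=> CF Ccl fF f'F fs; have [x [y [z [xy xz yz fE _]]]] := face_formP fF.
have f'E : face_supp f' = [set x; y; z] by rewrite -fs.
have [f0 [X [Y [Z [f0F -> F0 ZN]]]]] := face_corner CF Ccl fF xy xz yz fE.
have [f1 [X' [Y' [Z' [f1F -> F1 ZN']]]]] := face_corner CF Ccl f'F xy xz yz f'E.
have [-> [sX sY sZ] H] := F0; have [-> [sX' sY' sZ'] H'] := F1.
have SX := grid_sum3 xy xz yz sX; have SY := grid_sum3 xy xz yz sY.
have SZ := grid_sum3 xy xz yz sZ; have SX' := grid_sum3 xy xz yz sX'.
have SY' := grid_sum3 xy xz yz sY'; have SZ' := grid_sum3 xy xz yz sZ'.
case: H => -[[H1 H2] [H3 H4] [H5 H6]]; last by exfalso; nat_lia.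
case: H' => -[[H1' H2'] [H3' H4'] [H5' H6']]; last by exfalso; nat_lia.
have -> : X = X' by apply: (grid_ext3 sX sX'); nat_lia.
have -> : Y = Y' by apply: (grid_ext3 sY sY'); nat_lia.
by have -> : Z = Z' by apply: (grid_ext3 sZ sZ'); nat_lia.
Qed.

(** By [face_same_supp] everything depends on the set [S] of triangles of [K] met by [C]. It is
    closed under crossing edges of [K], hence under turning around a vertex ([link_closed]), and
    connectedness of the grid carries it everywhere. *)
Lemma grid_strongly_connected :
  connected_in (face_adj grid_faces) [set: grid] -> strongly_connected grid_faces.
Proof.
move=> conn C CF C0 Ccl.
pose S := [set A | [exists f in C, face_supp f == A]].
have dimP T : T \in faces_of_dim K 3 -> T \in K /\ #|T| = 3.
  by rewrite inE => /andP[? /eqP].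
have supp3 f : f \in grid_faces -> face_supp f \in faces_of_dim K 3.
  move=> fF; have [a [b [c [ab ac bc fE _]]]] := face_formP fF.
  by rewrite inE face_supp_in // fE card3 ab ac bc.
have SC f : f \in grid_faces -> face_supp f \in S -> f \in C.
  move=> fF; rewrite inE => /existsP[f' /andP[f'C /eqP E]].
  by rewrite (face_same_supp CF Ccl fF (subsetP CF _ f'C)).
have SF A : A \in S -> A \in faces_of_dim K 3.
  by rewrite inE => /existsP[f /andP[fC /eqP <-]]; apply: supp3; apply: (subsetP CF).
have Scl A B : A \in S -> B \in faces_of_dim K 3 -> #|A :&: B| = 2 -> B \in S.
  move=> AS BF AB2; have [AK A3] := dimP _ (SF _ AS); have [BK B3] := dimP _ BF.
  have /eqP/cards2P[a [b [ab ABE]]] := AB2.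
  have inAB w : w \in [set a; b] -> w \in A /\ w \in B by rewrite -ABE !inE => /andP.
  have [aA aB] := inAB a (set21 _ _); have [bA bB] := inAB b (set22 _ _).
  have ext (T : {set W}) : #|T| = 3 -> a \in T -> b \in T -> T \in K ->
      exists c, [/\ a != c, b != c & T = [set a; b; c]].
    move=> T3 aT bT TK; have [c] : exists c, c \in T :\ a :\ b.
      apply/set0Pn; rewrite -cards_eq0; have := cardsD1 a T; have := cardsD1 b (T :\ a).
      by rewrite aT T3 !inE bT eq_sym ab => ->; rewrite !add1n => -[<-].
    rewrite !inE ![c == _]eq_sym => /and3P[bc ac cT]; exists c; split=> //.
    by apply: set3E => //; rewrite T3.
  have [c [ac bc AE]] := ext A A3 aA bA AK; have [d [ad bd BE]] := ext B B3 aB bB BK.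
  have cd : c != d.
    apply/eqP => E; move: AB2; rewrite AE BE E setIid.
    by have /eqP -> : #|[set a; b; d]| == 3 by rewrite card3 ab ad bd.
  rewrite AE in AK; rewrite BE in BK.
  (* The small faces at the corner [a] lying along the edge [a b] on both sides share the side
     [p q], with [p = N e_a] and [q = (N - 1) e_a + e_b]. *)
  have [|p [pa pb pc sp]] := @grid_mk3 a b c N 0 0 ab ac bc AK; first by rewrite !addn0.
  have [|q [qa qb qc sq]] := @grid_mk3 a b c N.-1 1 0 ab ac bc AK; first by nat_lia.
  have [|r [ra rb rc sr]] := @grid_mk3 a b c N.-1 0 1 ab ac bc AK; first by nat_lia.
  have [|r' [ra' rb' rd' sr']] := @grid_mk3 a b d N.-1 0 1 ab ad bd BK; first by nat_lia.
  have toB x : gsupp x \subset [set a; b; c] -> gcoord x c = 0 ->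
      gcoord x d = 0 /\ gsupp x \subset [set a; b; d].
    move=> sx xc; have sab : gsupp x \subset [set a; b].
      apply/subsetP => w wx; have := subsetP sx w wx; rewrite !inE => /orP[//|/eqP wc].
      by move: wx; rewrite wc inE xc.
    split; last exact: subset_trans sab (subsetUl _ _).
    by apply: gcoord0 sab _; rewrite !inE negb_or ![d == _]eq_sym ad.
  have [pd sp'] := toB p sp pc; have [qd sq'] := toB q sq qc.
  have pq : p != q by apply: (@gcoord_neq _ _ b); nat_lia.
  have pr : p != r by apply: (@gcoord_neq _ _ c); nat_lia.
  have qr : q != r by apply: (@gcoord_neq _ _ c); nat_lia.
  have pr' : p != r' by apply: (@gcoord_neq _ _ d); nat_lia.
  have qr' : q != r' by apply: (@gcoord_neq _ _ d); nat_lia.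
  have rr' : r != r'.
    apply: (@gcoord_neq _ _ c); rewrite rc (gcoord0 sr') //.
    by rewrite !inE !negb_or ![c == _]eq_sym ac bc eq_sym cd.
  have npq : gnear p q by apply: (near_set3 sp sq); nat_lia.
  have fF : [set p; q; r] \in grid_faces.
    by apply: (face_mk AK) => //; [apply: (near_set3 sp sr)|apply: (near_set3 sq sr)]; nat_lia.
  have f'F : [set p; q; r'] \in grid_faces.
    by apply: (face_mk BK) => //; [apply: (near_set3 sp' sr')|apply: (near_set3 sq' sr')]; nat_lia.
  have fA : face_supp [set p; q; r] = A.
    rewrite AE; apply: face_supp_eq => //.
    by rewrite /face_supp bigcup_set3 !subUset sp sq sr.
  have f'B : face_supp [set p; q; r'] = B.
    rewrite BE; apply: face_supp_eq => //.
    by rewrite /face_supp bigcup_set3 !subUset sp' sq' sr'.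
  rewrite inE; apply/existsP; exists [set p; q; r']; rewrite f'B eqxx andbT.
  apply: (Ccl _ _ (SC _ fF _) f'F); first by rewrite fA.
  rewrite -setUIr; suff -> : [set r] :&: [set r'] = set0 by rewrite setU0 cards2 pq.
  by apply/setP => w; rewrite !inE; case: eqP => // ->; rewrite (negPf rr').
have [f0 f0C] := set0Pn _ C0; have f0F := subsetP CF _ f0C.
have S0 : face_supp f0 \in S by rewrite inE; apply/existsP; exists f0; rewrite f0C eqxx.
pose Q (p : grid) := [exists A in S, gsupp p \subset A].
have Qall p : Q p.
  have [p0 p0f] : exists p0, p0 \in f0.
    apply/set0Pn; rewrite -cards_eq0; move: f0F; rewrite inE => /and3P[/eqP -> _ _] //.
  have Qp0 : Q p0.
    by apply/existsP; exists (face_supp f0); rewrite S0 /=; apply: (bigcup_sup p0).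
  apply: contraT => nQ.
  have [a [b [/and3P[ab _ _] /existsP[A /andP[AS aA]] /negP[]]]] :=
    connect_switch (conn p0 p (in_setT _) (in_setT _)) Qp0 nQ.
  move: ab; rewrite grid_face_adjE => /and3P[_ _ UK].
  have [B BK [UB B3]] := complex_pure UK.
  have ne : gsupp a != set0 by apply: contraTneq (gsupp_in a) => ->; case: surfK => -[].
  have [v va] := set0Pn _ ne.
  have BF : B \in faces_of_dim K 3 by rewrite inE BK B3.
  apply/existsP; exists B; rewrite (subset_trans (subsetUr _ _) UB) andbT.
  apply: (link_closed Scl (SF _ AS) AS BF (subsetP aA _ va)).
  by apply: (subsetP UB); rewrite inE va.
apply/eqP; rewrite eqEsubset CF /=; apply/subsetP => f fF.
have [x [y [z [xy xz yz fE _]]]] := face_formP fF.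
apply: SC => //; rewrite fE.
have xyzF : [set x; y; z] \in faces_of_dim K 3 by rewrite -fE supp3.
have [xyzK _] := dimP _ xyzF.
have [|p [px _ _ _]] := @grid_mk3 x y z N 0 0 xy xz yz xyzK; first by rewrite !addn0.
have /existsP[A /andP[AS pA]] := Qall p.
apply: (link_closed Scl (SF _ AS) AS xyzF (v := x)); last by rewrite !inE eqxx.
by apply: (subsetP pA); rewrite inE px -lt0n.
Qed.
End Grid.

(** * Discretization of a topological embedding *)

Local Open Scope ring_scope.

(** On the realization this is the open star of [p] in the subdivision: inside a triangle, the open
    hexagon around [p]. *)
Definition star (R : realType) (W : finType) (K : {set {set W}}) (N : nat) (p : grid K N) :
    classical_sets.set 'rV[R]_(#|W|) :=
  fun x => forall w, `|N%:R * x ord0 (enum_rank w) - (gcoord p w)%:R| < 1.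

Definition nerve (R : realType) (W : finType) (K : {set {set W}}) (N : nat)
    (X : classical_sets.set 'rV[R]_(#|W|)) : {set grid K N} :=
  [set p | `[< exists2 x, X x & star p x >]].

Section Star.
Variables (R : realType) (W : finType) (K : {set {set W}}) (N : nat).
Hypotheses (surfK : surface_complex K) (N_gt0 : (0 < N)%N).
Implicit Types (p q : grid K N) (x y : 'rV[R]_(#|W|)).

Lemma star_open p : open (star (R := R) p).
Proof.
rewrite openE => x sx; rewrite /interior /=.
pose f (w : W) : classical_sets.set 'rV[R]_(#|W|) :=
  fun y => `|N%:R * y ord0 (enum_rank w) - (gcoord p w)%:R| < 1.
apply: (@filter_forall _ W f (nbhs x) _) => w; rewrite /f.
have cf : continuous (fun y : 'rV[R]_(#|W|) =>
    `|N%:R * y ord0 (enum_rank w) - (gcoord p w)%:R| : R).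
  move=> y; apply: (@continuous_comp _ _ _ (fun z : 'rV[R]_(#|W|) => z ord0 (enum_rank w))
    (fun t : R => `|N%:R * t - (gcoord p w)%:R| : R)); first exact: coord_continuous.
  apply: cvg_norm; apply: cvgB; last exact: cvg_cst.
  by apply: cvgMl_tmp; exact: cvg_id.
exact: (cvgr_lt _ (cf x) _ (sx w)).
Qed.

Lemma star_supp p x w : star p x -> x ord0 (enum_rank w) = 0 -> gcoord p w = 0%N.
Proof.
move=> /(_ w) + xw; rewrite xw mulr0 sub0r normrN ger0_norm // ltrn1.
by rewrite ltnS leqn0 => /eqP.
Qed.

Lemma star_gsupp p x : star p x -> gsupp p \subset [set w | x ord0 (enum_rank w) != 0].
Proof.
move=> sx; apply/subsetP => w; rewrite !inE; apply: contra => /eqP /(star_supp sx) ->.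
by rewrite eqxx.
Qed.

(** Both integer coordinates are within 1 of the same real, so they differ by less than 2; both
    supports lie in that of [x]. *)
Lemma star_grid_adj p q x : realization K x -> star p x -> star q x -> p != q -> grid_adj p q.
Proof.
move=> [x0 x1 xK] sp sq pq; apply/and3P; split=> //.
  apply/nearP => w; have := sp w; have := sq w; rewrite !ltr_norml.
  set a := N%:R * _ => /andP[h1 h2] /andP[h3 h4].
  have lt2 (m n : nat) : m%:R < n%:R + 2 :> R -> (m <= n.+1)%N.
    by rewrite -natrD ltr_nat addn2 ltnS.
  by split; apply: lt2; lra.
apply: (complex_sub surfK xK); first by rewrite subUset !star_gsupp.
have := gsupp_in p; apply: contraTneq => U0.
have -> : gsupp p = set0 by apply/eqP; rewrite -subset0 -U0 subsetUl.
by case: surfK => -[].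
Qed.

(* Rounding the partial sums of the coordinates keeps the total equal to [N]. *)
Lemma star_cover x : realization K x -> exists p, star p x.
Proof.
move=> [x0 x1 xK].
pose X (i : nat) : R := \sum_(j < #|W| | (j < i)%N) N%:R * x ord0 j.
have Xge0 i : 0 <= X i.
  apply: sumr_ge0 => j _; apply: mulr_ge0 => //.
  by rewrite -[j]enum_valK; exact: x0.
have XS (j : 'I_(#|W|)) : X j.+1 = X j + N%:R * x ord0 j.
  rewrite /X (bigD1 j) //= addrC; congr (_ + _); apply: eq_bigl => i.
  by rewrite ltnS ltn_neqAle andbC.
have Xmono (j : 'I_(#|W|)) : X j <= X j.+1.
  by rewrite XS lerDl mulr_ge0 // -[j]enum_valK x0.
(* The error at [w] is a difference of two fractional parts, hence less than 1 in absolute value. *)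
pose f (w : W) := (Num.truncn (X (enum_rank w).+1) - Num.truncn (X (enum_rank w)))%N.
have fle (j : 'I_(#|W|)) : (Num.truncn (X j) <= Num.truncn (X j.+1))%N.
  exact: le_truncn (Xmono j).
have fE w : (f w)%:R = (Num.truncn (X (enum_rank w).+1))%:R - (Num.truncn (X (enum_rank w)))%:R :> R.
  by rewrite natrB.
have flt w : `|N%:R * x ord0 (enum_rank w) - (f w)%:R| < 1.
  rewrite fE; have /andP[] := truncn_itv (Xge0 (enum_rank w)).
  have /andP[] := truncn_itv (Xge0 (enum_rank w).+1); rewrite XS -!natr1 ltr_norml.
  by move=> *; apply/andP; split; lra.
have fsum : (\sum_w f w)%N = N.
  rewrite (reindex_onto (@enum_val W predT) enum_rank) /=; last by move=> w _; exact: enum_rankK.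
  rewrite (eq_bigl xpredT); last by move=> j; rewrite enum_valK eqxx.
  under eq_bigr do rewrite /f enum_valK.
  rewrite -(big_mkord xpredT (fun j => Num.truncn (X j.+1) - Num.truncn (X j))%N).
  rewrite telescope_sumn_in //; last by move=> j /= jW; exact: (fle (Ordinal jW)).
  have -> : X 0%N = 0 by rewrite /X big_pred0.
  have -> : X #|W| = N%:R.
    rewrite /X (eq_bigl xpredT); last by move=> j; rewrite ltn_ord.
    rewrite -mulr_sumr -[RHS]mulr1 -x1; congr (_ * _).
    rewrite [RHS](reindex_onto (@enum_val W predT) enum_rank) /=; last by move=> w _; exact: enum_rankK.
    by apply: eq_big => j; rewrite enum_valK ?eqxx.
  by rewrite natrK truncn0 subn0.
have fsupp : [set w | f w != 0%N] \subset [set w | x ord0 (enum_rank w) != 0].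
  apply/subsetP => w; rewrite !inE; apply: contra => /eqP xw.
  by rewrite /f XS xw mulr0 addr0 subnn.
have [||p pE] := @grid_mk _ K N f => //.
  apply: (complex_sub surfK xK) => //; apply: contraTneq N_gt0 => f00.
  rewrite -fsum big1 // => w _; apply/eqP; apply: contraT => fw.
  by have : w \in [set w | f w != 0%N] by [rewrite inE]; rewrite f00 inE.
by exists p => w; rewrite pE.
Qed.

Lemma nerveP p (X : classical_sets.set 'rV[R]_(#|W|)) :
  p \in nerve K N X <-> exists2 x, X x & star p x.
Proof. by rewrite inE; split=> [/asboolP|H]; [|apply/asboolP]. Qed.

(** The stars reachable from [p] and the unreachable ones form two open sets covering [X]. They are
    disjoint on [X] because stars meeting there have equal or adjacent centers. *)
Lemma nerve_connected (X : classical_sets.set 'rV[R]_(#|W|)) :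
    (forall x, X x -> realization K x) -> connected X ->
  connected_in (face_adj (grid_faces K N)) (nerve K N X).
Proof.
move=> XK Xc p q pX qX.
pose r a b := [&& face_adj (grid_faces K N) a b, a \in nerve K N X & b \in nerve K N X].
pose O (good : bool) : classical_sets.set 'rV[R]_(#|W|) :=
  (\bigcup_(a in (fun a => a \in nerve K N X /\ connect r p a = good)) star a)%classic.
have Oopen good : open (O good) by apply: bigcup_open => a _; exact: star_open.
have cover x : X x -> O true x \/ O false x.
  move=> Xx; have [a ax] := star_cover (XK _ Xx).
  have aX : a \in nerve K N X by apply/nerveP; exists x.
  have [pa|pa] := boolP (connect r p a); [left|right]; exists a => //; split=> //.
  exact: negPf.
have disj x : X x -> O true x -> O false x -> False.
  move=> Xx [a [aX pa] ax] [b [bX pb] bx].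
  suff : connect r p b by rewrite pb.
  have [<-//|ab] := eqVneq a b; apply: connect_trans (pa : is_true _) (connect1 _).
  by rewrite /r aX bX grid_face_adjE // (star_grid_adj (XK _ Xx) ax bx ab).
have XE : (X `&` O true)%classic = X.
  apply: Xc.
  - have /nerveP[x Xx px] := pX; exists x; split=> //; exists p => //.
    by split; rewrite ?connect0.
  - by exists (O true).
  - exists (~` O false)%classic; first exact: open_closedC.
    apply/classical_sets.seteqP; split=> x [Xx Ox]; split=> //.
      exact: disj.
    by have [|/Ox] := cover x Xx.
have /nerveP[x Xx qx] := qX.
have [_ [a [aX pa] ax]] : (X `&` O true)%classic x by rewrite XE.
have [<-//|aq] := eqVneq a q; apply: connect_trans (pa : is_true _) (connect1 _).
by rewrite /r aX qX grid_face_adjE // (star_grid_adj (XK _ Xx) ax qx aq).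
Qed.

Lemma star_dist p x y w : star p x -> star p y ->
  `|x ord0 (enum_rank w) - y ord0 (enum_rank w)| < 2 / N%:R.
Proof.
move=> /(_ w) px /(_ w) py; have N0 : 0 < N%:R :> R by rewrite ltr0n.
rewrite ltr_pdivlMr // -[X in _ * X](gtr0_norm N0) -normrM mulrC mulrBr.
have -> : N%:R * x ord0 (enum_rank w) - N%:R * y ord0 (enum_rank w) =
  (N%:R * x ord0 (enum_rank w) - (gcoord p w)%:R) -
  (N%:R * y ord0 (enum_rank w) - (gcoord p w)%:R) by rewrite opprB addrA subrK.
by apply: le_lt_trans (ler_normB _ _) _; rewrite -[2]/(1 + 1) ltrD.
Qed.

Lemma nerve_realization : nerve K N (realization (R := R) K) = [set: grid K N].
Proof.
apply/setP => p; rewrite [RHS]inE; apply/nerveP.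
have N0 : 0 < N%:R :> R by rewrite ltr0n.
have xE w : (\row_j ((gcoord p (enum_val j))%:R / N%:R) : 'rV[R]_(#|W|)) ord0 (enum_rank w)
    = (gcoord p w)%:R / N%:R by rewrite mxE enum_rankK.
exists (\row_j ((gcoord p (enum_val j))%:R / N%:R)); last first.
  by move=> w; rewrite xE mulrCA divff ?mulr1 ?subrr ?normr0 // lt0r_neq0.
split=> [w||]; first by rewrite xE divr_ge0 ?ler0n.
  under eq_bigr do rewrite xE.
  by rewrite -mulr_suml -natr_sum grid_sum divff // lt0r_neq0.
have -> : [set w | (\row_j ((gcoord p (enum_val j))%:R / N%:R) : 'rV[R]_(#|W|)) ord0 (enum_rank w) != 0]
    = gsupp p; last exact: gsupp_in.
apply/setP => w; rewrite !inE xE mulf_eq0 invr_eq0 !pnatr_eq0.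
by rewrite -[N == 0%N]leqn0 leqNgt N_gt0 orbF.
Qed.

Lemma nerve_disjoint (X Y : classical_sets.set 'rV[R]_(#|W|)) :
    (forall x y, X x -> Y y -> ~ forall w,
       `|x ord0 (enum_rank w) - y ord0 (enum_rank w)| < 2 / N%:R) ->
  [disjoint nerve K N X & nerve K N Y].
Proof.
move=> sep; apply/pred0P => p; apply/negP => /= /andP[/nerveP[x Xx px] /nerveP[y Yy py]].
by apply: (sep x y) => // w; exact: star_dist px py.
Qed.

End Star.

(** The differences [x - y] form a compact set avoiding 0, hence avoiding a ball around 0, and
    [2 / N] eventually drops below its radius. *)
Lemma compact_separation (R : realType) (n : nat) (A B : classical_sets.set 'rV[R]_n) :
    compact A -> compact B -> (A `&` B)%classic = classical_sets.set0 ->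
  exists m : nat, forall N, (m < N)%N -> forall x y, A x -> B y ->
    ~ forall i, `|x ord0 i - y ord0 i| < 2 / N%:R.
Proof.
move=> cA cB AB0.
pose D := ((fun z : 'rV[R]_n * 'rV[R]_n => z.1 - z.2) @` (A `*` B))%classic.
have coD : compact D.
  apply: continuous_compact; last exact: compact_setX.
  apply: continuous_subspaceT => z; apply: cvgB; [exact: cvg_fst|exact: cvg_snd].
have cD := compact_closed (@norm_hausdorff _ _) coD.
have D0 : (~` D)%classic 0.
  move=> [[x y] /= [Ax By]] /eqP; rewrite subr_eq0 => /eqP xy.
  suff : (A `&` B)%classic x by rewrite AB0.
  by split=> //; rewrite xy.
have /nbhs_ballP[eps /= eps0 epsD] : nbhs (0 : 'rV[R]_n) (~` D)%classic.
  by apply: open_nbhs_nbhs; split=> //; exact: closed_openC.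
exists (Num.truncn (2 / eps)) => N mN x y Ax By xy.
have lt : 2 / N%:R < eps.
  have N0 : 0 < N%:R :> R by rewrite ltr0n (leq_trans _ mN).
  rewrite ltr_pdivrMr // mulrC -ltr_pdivrMr //.
  apply: lt_le_trans (truncnS_gt _) _; by rewrite ler_nat.
apply: (epsD (x - y)); last by exists (x, y).
split=> // i j; rewrite !mxE /ball /= sub0r normrN ord1.
exact: lt_trans (xy j) lt.
Qed.

Definition edge_point (R : realType) (V : finType) (u v : V) (t : R) : 'rV[R]_(#|V|) :=
  \row_j (t * (enum_val j == u)%:R + (1 - t) * (enum_val j == v)%:R).

Lemma edge_pointE (R : realType) (V : finType) (u v w : V) (t : R) :
  edge_point u v t ord0 (enum_rank w) = t * (w == u)%:R + (1 - t) * (w == v)%:R.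
Proof. by rewrite mxE enum_rankK. Qed.

Lemma edge_point_sym (R : realType) (V : finType) (u v : V) (t : R) :
  edge_point u v t = edge_point v u (1 - t).
Proof. by apply/rowP => j; rewrite !mxE subKr addrC. Qed.

Lemma edge_point_continuous (R : realType) (V : finType) (u v : V) :
  continuous (fun t : R => edge_point u v t).
Proof.
pose a : 'rV[R]_(#|V|) := \row_j (enum_val j == u)%:R.
pose b : 'rV[R]_(#|V|) := \row_j (enum_val j == v)%:R.
have -> : (fun t : R => edge_point u v t) = (fun t : R => b + t *: (a - b)).
  by apply/funext => t; apply/rowP => j; rewrite !mxE; ring.
move=> t; apply: cvgD; first exact: cvg_cst.
by apply: cvgZr_tmp; exact: cvg_id.
Qed.

Lemma edge_point_realization (R : realType) (V : finType) (e : rel V) (u v : V) (t : R) :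
  e u v || (u == v) -> 0 <= t <= 1 -> realization (graph_complex e) (edge_point u v t).
Proof.
move=> uv /andP[t0 t1].
split=> [w||]; first by rewrite edge_pointE addr_ge0 // mulr_ge0 ?ler0n // subr_ge0.
  under eq_bigr do rewrite edge_pointE.
  rewrite big_split /= -!mulr_sumr.
  have s1 x : \sum_(w : V) (w == x)%:R = 1 :> R.
    by rewrite (bigD1 x) //= eqxx big1 ?addr0 // => w /negPf ->.
  by rewrite !s1 !mulr1 addrC subrK.
set A := [set w | _]; rewrite inE.
have vert x : A = [set x] -> [exists u0, A == [set u0]] by move=> ->; apply/existsP; exists x.
have [E|uv'] := eqVneq u v.
  rewrite (vert u) //; apply/setP => w; rewrite !inE edge_pointE -E -mulrDl addrC subrK mul1r.
  by rewrite pnatr_eq0; case: (w == u).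
have [T|t'] := eqVneq t 0.
  rewrite (vert v) //; apply/setP => w; rewrite !inE edge_pointE T mul0r add0r subr0 mul1r.
  by rewrite pnatr_eq0; case: (w == v).
have [T|t''] := eqVneq t 1.
  rewrite (vert u) //; apply/setP => w; rewrite !inE edge_pointE T subrr mul0r addr0 mul1r.
  by rewrite pnatr_eq0; case: (w == u).
apply/orP; right; apply/existsP; exists u; apply/existsP; exists v.
move: uv; rewrite (negPf uv') orbF => ->; apply/eqP/setP => w; rewrite !inE edge_pointE.
have [->|wu] := eqVneq w u; first by rewrite (negPf uv') mulr0 addr0 mulr1 t'.
by case: (w == v); rewrite ?mulr1 ?mulr0 ?add0r ?eqxx // subr_eq0 eq_sym.
Qed.

(* Cut every edge of the embedded graph into thirds: the outer thirds form the
   branch sets, the middle ones the bridges. *)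
Lemma embedding_minor_model (R : realType) (V W : finType) (e : rel V) (K : {set {set W}})
    (S : topologicalType) :
    symmetric e -> irreflexive e -> surface_complex K -> connected (@classical_sets.setT S) ->
    homeomorphic (realization (R := R) K) (@classical_sets.setT S) -> graph_embeds R e S ->
  exists N X Y, [/\ (0 < N)%N, minor_model (grid_faces K N) e X Y &
    connected_in (face_adj (grid_faces K N)) [set: grid K N]].
Proof.
move=> esym eirr surfK Sc [f1 [h1 [f1c h1c f1P h1P]]] [A [f2 [h2 [f2c h2c f2P h2P]]]].
pose G := realization (R := R) (graph_complex e).
pose ga : 'rV[R]_(#|V|) -> 'rV[R]_(#|W|) := h1 \o f2.
have h1c' : continuous h1 by apply/continuous_subspace_setT.
have gac : {within G, continuous ga}%classic.
  by move=> x; apply: (@continuous_comp (subspace G) S _ f2 h1 x (f2c x) (h1c' (f2 x))).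
have gaK x : G x -> realization K (ga x) by move=> _; have [] := h1P (f2 x) I.
have gaI x y : G x -> G y -> ga x = ga y -> x = y.
  move=> Gx Gy E; have [_ ex] := f2P x Gx; have [_ ey] := f2P y Gy.
  have [_ kx] := h1P (f2 x) I; have [_ ky] := h1P (f2 y) I.
  by rewrite -ex -kx -[h1 _]/(ga x) E /ga /= ky.
pose thirds (b : bool) : classical_sets.set R :=
  if b then `[2 / 3, 1]%classic else `[1 / 3, 2 / 3]%classic.
have thirds01 b t : thirds b t -> 0 <= t <= 1.
  by rewrite /thirds; case: b; rewrite /= in_itv /= => /andP[? ?]; apply/andP; split; lra.
(* The parameter [1] is the vertex [i.1.2], so [true] gives the third next to it and [false] the
   middle one. The degenerate case of equal ends is the vertex alone, which gives isolated vertices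
   a branch set. *)
pose piece (i : bool * V * V) : classical_sets.set 'rV[R]_(#|V|) :=
  if e i.1.2 i.2 || (i.1.2 == i.2) then (edge_point i.1.2 i.2 @` thirds i.1.1)%classic
  else classical_sets.set0.
have pieceG i x : piece i x -> G x.
  rewrite /piece; case: ifP => // ok [t tt <-].
  by apply: edge_point_realization ok _; exact: thirds01 tt.
pose C i := (ga @` piece i)%classic.
have gap i : {within piece i, continuous ga}%classic.
  by apply: continuous_subspaceW gac => x; exact: pieceG.
have pc i : compact (piece i) /\ connected (piece i).
  rewrite /piece; case: ifP => _; last by split; [exact: compact0|exact: connected0].
  have ec := continuous_subspaceT (@edge_point_continuous R V i.1.2 i.2).
  split; [apply: continuous_compact => //|apply: connected_continuous_connected => //];
    rewrite /thirds; case: i.1.1; by [exact: segment_compact|exact: segment_connected].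
have cC i : compact (C i) by apply: continuous_compact => //; have [] := pc i.
have conC i : connected (C i).
  by apply: connected_continuous_connected => //; have [] := pc i.
(* There are finitely many pieces, so one [N] separates all disjoint pairs at once. *)
have [M sep] : exists M, forall i j, (piece i `&` piece j)%classic = classical_sets.set0 ->
    forall N, (M < N)%N -> forall x y, C i x -> C j y ->
    ~ forall w, `|x ord0 w - y ord0 w| < 2 / N%:R.
  have m1 (ij : (bool * V * V) * (bool * V * V)) : exists m,
      (piece ij.1 `&` piece ij.2)%classic = classical_sets.set0 ->
      forall N, (m < N)%N -> forall x y, C ij.1 x -> C ij.2 y ->
      ~ forall w, `|x ord0 w - y ord0 w| < 2 / N%:R.
    have [E|] := pselect ((piece ij.1 `&` piece ij.2)%classic = classical_sets.set0); last first.
      by move=> E; exists 0%N.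
    have [|m mP] := compact_separation (cC ij.1) (cC ij.2); last by exists m.
    rewrite -classical_sets.subset0 => z [[x Px <-] [y Py /gaI yx]].
    have : (piece ij.1 `&` piece ij.2)%classic x.
      by split=> //; rewrite -(yx (pieceG _ _ Py) (pieceG _ _ Px)).
    by rewrite E.
  have [m mP] := choice m1; exists (\max_ij m ij)%N => i j E N lt.
  by apply: (mP (i, j) E); apply: leq_ltn_trans lt; exact: leq_bigmax.
pose N := M.+1.
have N0 : (0 < N)%N by [].
have disj i j : (forall x, piece i x -> piece j x -> False) ->
    [disjoint nerve K N (C i) & nerve K N (C j)].
  move=> H; apply: nerve_disjoint => // x y Cx Cy H'.
  have E : (piece i `&` piece j)%classic = classical_sets.set0.
    by rewrite -classical_sets.subset0 => z [/H].
  by apply: (sep i j E N (leqnn _) x y Cx Cy) => w; rewrite -[w]enum_valK.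
pose X v : {set grid K N} :=
  nerve K N (\bigcup_(u in (fun u => e v u || (v == u))) C (true, v, u))%classic.
pose Y u v : {set grid K N} := nerve K N (C (false, u, v)).
have XP p v : p \in X v -> exists u, p \in nerve K N (C (true, v, u)).
  by move=> /nerveP[z [u _ Cz] pz]; exists u; apply/nerveP; exists z.
have CK i x : C i x -> realization K x by move=> [z Pz <-]; apply: gaK; exact: pieceG Pz.
have disjP (P Q : {set grid K N}) : (forall p, p \in P -> p \in Q -> False) -> [disjoint P & Q].
  by move=> H; apply/pred0P => p; apply/negP => /= /andP[pP pQ]; exact: H pP pQ.
have disjE (P Q : {set grid K N}) p : [disjoint P & Q] -> p \in P -> p \in Q -> False.
  by move=> /pred0P /(_ p) /= + pP pQ; rewrite pP pQ.
(* Barycentric coordinates tell the pieces apart: an outer third has a coordinate at least [2 / 3]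
   at its vertex, and a middle third is supported exactly on the ends of its edge. *)
have big v u x : piece (true, v, u) x -> 2 / 3 <= x ord0 (enum_rank v).
  rewrite /piece /=; case: ifP => // _ [t]; rewrite /thirds /= in_itv /= => /andP[t1 t2] <-.
  by rewrite edge_pointE eqxx mulr1; case: (v == u); rewrite ?mulr1 ?mulr0; clear -t1 t2; lra.
have small b v u w x : piece (b, v, u) x -> w != v ->
    x ord0 (enum_rank w) <= (if b then 1 / 3 else 2 / 3) /\ (w != u -> x ord0 (enum_rank w) = 0).
  rewrite /piece /=; case: ifP => // _ [t tt <-] wv; rewrite edge_pointE (negPf wv) mulr0 add0r.
  move: tt; rewrite /thirds; case: b; rewrite /= in_itv /= => /andP[t1 t2];
    by case: (w == u); split=> //; rewrite ?mulr1 ?mulr0; clear -t1 t2; lra.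
have mid u v x : u != v -> piece (false, u, v) x ->
    0 < x ord0 (enum_rank u) /\ 0 < x ord0 (enum_rank v).
  move=> uv; rewrite /piece /=; case: ifP => // _ [t]; rewrite /thirds /= in_itv /= => /andP[t1 t2] <-.
  rewrite !edge_pointE !eqxx (negPf uv) [v == u]eq_sym (negPf uv) !mulr1 !mulr0; split; lra.
(* The thirds are closed, so consecutive ones share the point of parameter [2 / 3], and any star
   around its image is in both nerves. *)
have meet u v : e u v -> exists p, p \in X u /\ p \in Y u v.
  move=> uv; pose x := edge_point u v (2 / 3 : R).
  have xX : piece (true, u, v) x.
    by rewrite /piece /= uv /=; exists (2 / 3) => //; rewrite /thirds /= in_itv /=; lra.
  have xY : piece (false, u, v) x.
    by rewrite /piece /= uv /=; exists (2 / 3) => //; rewrite /thirds /= in_itv /=; lra.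
  have [p px] := star_cover surfK N0 (gaK _ (pieceG _ _ xX)).
  exists p; split; apply/nerveP; exists (ga x) => //; last by exists x.
  by exists v; [rewrite /= uv|exists x].
have Ysym u v : e u v -> Y u v = Y v u.
  move=> uv; congr (nerve K N (ga @` _)%classic); rewrite /piece /= uv esym uv /=.
  apply/classical_sets.seteqP; split=> x [t tt <-]; exists (1 - t); rewrite -?edge_point_sym //;
    by move: tt; rewrite /thirds /= !in_itv /=; lra.
exists N, X, Y; split=> //; last first.
  rewrite -(@nerve_realization R W K N N0); apply: nerve_connected => //.
  have <- : (h1 @` classical_sets.setT)%classic = realization (R := R) K.
    apply/classical_sets.seteqP; split=> x.
      by move=> [s _ <-]; have [] := h1P s I.
    by move=> Kx; have [_ E] := f1P x Kx; exists (f1 x).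
  by apply: connected_continuous_connected => //; exact: continuous_subspaceT.
split.
- move=> v; split.
    have xX : piece (true, v, v) (edge_point v v 1).
      by rewrite /piece /= eqxx orbT; exists 1 => //; rewrite /thirds /= in_itv /=; lra.
    have [p px] := star_cover surfK N0 (gaK _ (pieceG _ _ xX)).
    apply/set0Pn; exists p; apply/nerveP; exists (ga (edge_point v v 1)) => //.
    by exists v; [rewrite /= eqxx orbT|exists (edge_point v v 1)].
  apply: nerve_connected => //; first by move=> x [u _]; exact: CK.
  apply: bigcup_connected => [|u _]; last exact: conC.
  exists (ga (edge_point v v 1)) => u vu; exists (edge_point v u 1).
    by rewrite /piece /= vu; exists 1 => //; rewrite /thirds /= in_itv /=; lra.
  by congr ga; apply/rowP => j; rewrite !mxE subrr !mul0r.
- move=> u v uv; apply: disjP => p /XP[a pa] /XP[b pb]; apply: disjE pa pb.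
  apply: disj => x xu xv; have := big _ _ _ xu; have [le _] := small _ _ _ _ _ xv uv.
  move: le => /=; lra.
- move=> u v uv; split; first exact: nerve_connected (CK _) (conC _).
    by have [p [pX pY]] := meet u v uv; apply/set0Pn; exists p; rewrite inE pX.
  have vu : e v u by rewrite esym.
  by have [p [pX pY]] := meet v u vu; apply/set0Pn; exists p; rewrite inE pX Ysym.
- move=> u v w uv; rewrite !inE negb_or => /andP[wu wv].
  apply: disjP => p /XP[a pa] pY; apply: disjE pa pY; apply: disj => x xw xY.
  have := big _ _ _ xw; have [_ /(_ wv) ->] := small _ _ _ _ _ xY wu; lra.
- move=> u v u' v' uv u'v' ne; apply: disj => x x1 x2; move/eqP: ne; apply.
  have nuv a b : e a b -> a != b by apply: contraTneq => ->; rewrite eirr.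
  have suppE a b : e a b -> piece (false, a, b) x ->
      [set a; b] = [set w | x ord0 (enum_rank w) != 0].
    move=> ab xab; have [xa xb] := mid _ _ _ (nuv _ _ ab) xab.
    apply/setP => w; rewrite !inE.
    have [->|wa] := eqVneq w a; first by rewrite gt_eqF.
    have [->|wb] := eqVneq w b; first by rewrite gt_eqF.
    by have [_ /(_ wb) ->] := small _ _ _ _ _ xab wa; rewrite eqxx.
  by rewrite (suppE _ _ uv x1) (suppE _ _ u'v' x2).
Qed.

(** * Vertices of low degree *)

Local Open Scope nat_scope.

Lemma graph_edgesE (V : finType) (e : rel V) u v :
  symmetric e -> irreflexive e -> ([set u; v] \in graph_edges e) = e u v.
Proof.
move=> esym eirr; rewrite inE; apply/existsP/idP => [[x /existsP[y /andP[exy /eqP E]]]|euv].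
  have xy : x != y by apply: contraTneq exy => ->; rewrite eirr.
  have : x \in [set u; v] by rewrite E !inE eqxx.
  have : y \in [set u; v] by rewrite E !inE eqxx orbT.
  rewrite !inE => /orP[]/eqP yE /orP[]/eqP xE; move: xy exy; rewrite xE yE ?eqxx //.
  by rewrite esym.
by exists u; apply/existsP; exists v; rewrite euv eqxx.
Qed.

Lemma minor_model_sub (P V : finType) (F : {set {set P}}) (e : rel V) X Y (V1 : {set V}) :
  minor_model F e X Y ->
  minor_model F (fun u v : {v | v \in V1} => e (val u) (val v))
    (fun u => X (val u)) (fun u v => Y (val u) (val v)).
Proof.
case=> Xc Xd Yc XYd Yd.
have vI (u v : {v | v \in V1}) : val @: [set u; v] = [set val u; val v].
  by rewrite imsetU1 imset_set1.
split=> //.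
- by move=> u v uv; apply: Xd; rewrite (inj_eq val_inj).
- by move=> u v uv; exact: Yc.
- move=> u v w uv; rewrite !inE => wuv; apply: XYd => //.
  by rewrite !inE !(inj_eq val_inj).
- move=> u v u' v' uv u'v' ne; apply: Yd => //.
  by rewrite -!vI (inj_eq (imset_inj val_inj)).
Qed.

(** For the [m] edges induced on [n = #|V1|] vertices, [minor_edge_bound] and [grid_euler] give
    [m <= 3 n + 3 g - 3]. Degrees all at least 7 would give [7 n <= 2 m <= 6 n + 6 g - 6]. *)
Lemma genus_low_degree (R : realType) (V : finType) (e : rel V) (g : nat) (V1 : {set V}) :
    symmetric e -> irreflexive e -> is_euler_genus R e g -> 6 * g < #|V1| ->
  exists2 v, v \in V1 & #|[set u in V1 | e v u]| <= 6.
Proof.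
move=> esym eirr [[S [c [[_ _ _ Sc _] eS [W [K [surfK hK cE]]] gE]]] _] V1g.
have [N [X [Y [N0 XY conn]]]] := embedding_minor_model esym eirr surfK Sc hK eS.
apply/exists_inP; apply: contraT => /exists_inPn deg.
pose T := {v | v \in V1}; pose e1 (u v : T) := e (val u) (val v).
have e1sym : symmetric e1 by move=> u v; exact: esym.
have e1irr : irreflexive e1 by move=> u; exact: eirr.
have cardT : #|{: T}| = #|V1| by rewrite card_sig; apply: eq_card => v; rewrite !inE.
have T0 : 0 < #|{: T}| by rewrite cardT; apply: leq_ltn_trans V1g.
have bound := minor_edge_bound e1irr (grid_pseudosurface surfK N0)
  (grid_strongly_connected surfK N0 conn) conn (minor_model_sub V1 XY) T0.
have euler := grid_euler surfK N0.
have [ps FE] := complex_pseudosurface surfK.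
have := pseudosurface_card ps; rewrite FE => F32.
have deg7 : 7 * #|V1| <= 2 * #|graph_edges e1|.
  rewrite -(handshake (E := graph_edges e1)); last first.
    move=> A; rewrite inE => /existsP[u /existsP[v /andP[uv /eqP ->]]]; rewrite cards2.
    by case: eqP uv => // ->; rewrite e1irr.
  rewrite -cardT mulnC -sum_nat_const; apply: leq_sum => u _.
  have := deg _ (valP u); rewrite -ltnNge => /leq_trans; apply.
  rewrite -(card_imset _ val_inj); apply: subset_leq_card; apply/subsetP => v.
  rewrite inE => /andP[vV1 uv]; apply/imsetP; exists (Sub v vV1); rewrite ?SubK //.
  by rewrite inE graph_edgesE // /e1 SubK.
move: gE; rewrite cE /complex_euler_char -/(faces_of_dim K 1) -/(faces_of_dim K 2) -/(faces_of_dim K 3).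
rewrite cardT in bound; rewrite -/e1 in bound.
move: bound euler F32 deg7 V1g.
move: #|{: grid K N}| #|face_edges _| #|graph_edges _| #|V1| => a b m n.
move: #|faces_of_dim K 1| #|faces_of_dim K 2| #|faces_of_dim K 3| => x y z.
clear; lia.
Qed.

(** * Oriented coloring of sparse graphs *)

Definition tournament (T : finType) (tau : rel T) : Prop :=
  (forall x, ~~ tau x x) /\ (forall x y, x != y -> tau x y = ~~ tau y x).

(** Every family of bits yields a tournament, so the sample space is a plain function type; flipping
    the single bit at [(x, y)], for distinct [x] and [y], reverses their arc. *)
Definition tournament_of (T : finType) (w : {ffun T * T -> bool}) : rel T :=
  fun x y => w (x, y) (+) w (y, x) (+) (enum_rank x < enum_rank y).

Lemma tournament_ofP (T : finType) (w : {ffun T * T -> bool}) : tournament (tournament_of w).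
Proof.
split=> [x|x y xy]; first by rewrite /tournament_of addbb ltnn.
have nr : (enum_rank x == enum_rank y :> nat) = false.
  by apply: contraNF xy => /eqP/val_inj/enum_rank_inj ->.
have ne : (enum_rank x < enum_rank y) = ~~ (enum_rank y < enum_rank x).
  by rewrite -leqNgt [RHS]leq_eqVlt nr.
rewrite /tournament_of ne.
by case: (w (x, y)); case: (w (y, x)); case: (_ < _).
Qed.

(* Shifting the bits between [pos j] and [S] by all the families of subsets of [S]
   equidistributes the adjacencies, whence the proportion of bad choices. *)
Lemma card_bad_choices (T J : finType) (pos : J -> T) (S s : {set T}) :
    injective pos -> (forall j, pos j \notin S) ->
  #|[set w | [forall j, [exists x in S, tournament_of w (pos j) x != (x \in s)]]]|
    * (2 ^ #|S|) ^ #|J| = #|{: {ffun T * T -> bool}}| * (2 ^ #|S| - 1) ^ #|J|.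
Proof.
move=> posI posS; set bad := [set w | _].
pose sh (u : {ffun J -> {set T}}) (w : {ffun T * T -> bool}) : {ffun T * T -> bool} :=
  [ffun xy => w xy (+) [exists j, (xy.1 == pos j) && (xy.2 \in u j)]].
have shK u : involutive (sh u) by move=> w; apply/ffunP => xy; rewrite !ffunE addbK.
pose U := [set u : {ffun J -> {set T}} | [forall j, u j \subset S]].
have card_fam (F : J -> pred {set T}) n : (forall j, #|F j| = n) ->
    #|[set u : {ffun J -> {set T}} | [forall j, u j \in F j]]| = n ^ #|J|.
  move=> Fn; have -> : [set u : {ffun J -> {set T}} | [forall j, u j \in F j]] = [set u in family F].
    by apply/setP => u; rewrite !inE; apply: eq_forallb.
  rewrite cardsE card_family /image_mem cardT.
  by elim: (enum J) => //= j l ->; rewrite Fn expnS.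
have cardU : #|U| = (2 ^ #|S|) ^ #|J|.
  rewrite -(@card_fam (fun j => mem (powerset S))); last by move=> j; rewrite card_powerset.
  by apply: eq_card => u; rewrite !inE; apply: eq_forallb => j; rewrite inE.
have tour_sh u w j x : u \in U -> x \in S ->
    tournament_of (sh u w) (pos j) x = tournament_of w (pos j) x (+) (x \in u j).
  rewrite inE => /forallP uS xS; rewrite /tournament_of !ffunE /=.
  have -> : [exists j0, (pos j == pos j0) && (x \in u j0)] = (x \in u j).
    apply/existsP/idP => [[j0 /andP[/eqP/posI <-]]//|xu]; by exists j; rewrite eqxx.
  have -> : [exists j0, (x == pos j0) && (pos j \in u j0)] = false.
    by apply/existsP => -[j0 /andP[/eqP E _]]; have := posS j0; rewrite -E xS.
  rewrite addbF; move: (w _) (w _) (_ < _) (_ \in _) => a b c d.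
  by case: a; case: b; case: c; case: d.
(* [v w j] is the set of wrong adjacencies of [pos j]. A shift by [u] repairs position [j] exactly
   when [u j] is this set. *)
pose v w j := [set x in S | tournament_of w (pos j) x != (x \in s)].
have badE u w : u \in U -> (sh u w \in bad) = [forall j, u j != v w j].
  move=> uU; rewrite inE; apply: eq_forallb => j; have uS : u j \subset S.
    by move: uU; rewrite inE => /forallP.
  apply/exists_inP/idP => [[x xS]|ne].
    rewrite tour_sh // => H; apply/eqP => E; move: H; rewrite E inE xS /=.
    by case: (tournament_of _ _ _); case: (x \in s).
  apply/exists_inP; apply: contraNT ne => /exists_inPn H; apply/eqP/setP => x; rewrite inE.
  case: (boolP (x \in S)) => [xS|xS] /=; last by apply: contraNF xS; exact: (subsetP uS).
  have := H x xS; rewrite tour_sh // negbK => /eqP <-.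
  by case: (tournament_of _ _ _); case: (x \in u j).
(* Pairs of a [w] and a shift [u] making it bad are counted twice: each [w] has [2 ^ #|S| - 1]
   choices for every [u j], and each shift is a bijection of the sample space. *)
transitivity (\sum_(w : {ffun T * T -> bool}) \sum_(u in U | sh u w \in bad) 1); last first.
  rewrite -sum_nat_const; apply: eq_bigr => w _; rewrite sum1dep_card.
  rewrite -(@card_fam (fun j => [pred A | A \in powerset S :\ v w j])); last first.
    move=> j; have := cardsD1 (v w j) (powerset S).
    have -> : v w j \in powerset S by rewrite inE; apply/subsetP => x; rewrite inE => /andP[].
    by rewrite card_powerset add1n => ->; rewrite subn1 /=; apply: eq_card => A; rewrite !inE.
  apply: eq_card => u; rewrite [in LHS]inE; have [uU|uU] /= := boolP (u \in U); last first.
    rewrite inE; apply/esym/forallP => H; case/negP: uU; rewrite inE; apply/forallP => j.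
    by have := H j; rewrite !inE => /andP[].
  rewrite badE // inE; apply: eq_forallb => j; move: uU; rewrite !inE => /forallP /(_ j) ->.
  by rewrite andbT.
rewrite mulnC -cardU -sum_nat_const.
rewrite (exchange_big_dep (fun u => u \in U)) /=; last by move=> w u _ /andP[].
apply: eq_bigr => u uU; rewrite sum1dep_card -(card_imset _ (inv_inj (shK u))).
apply: eq_card => w; apply/idP/imsetP => [wb|[w' + ->]]; last by rewrite inE uU.
by exists (sh u w); rewrite ?shK // inE uU /= shK.
Qed.

(* The probabilistic method: the union bound over all the constraints. *)
Lemma universal_tournament (B C J : finType) (d : nat) :
    #|C| * (2 * (#|B| + #|C| * #|J|) + 1) ^ d * (2 ^ d - 1) ^ #|J| < (2 ^ d) ^ #|J| ->
  exists tau : rel (B + C * J), tournament tau /\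
    forall c (S s : {set B + C * J}), #|S| <= d -> (forall j, inr (c, j) \notin S) ->
      exists j, forall x, x \in S -> tau (inr (c, j)) x = (x \in s).
Proof.
set T := (B + C * J)%type => lt.
(* A constraint is coded by [d] optional pairs of a vertex and a prescribed bit, [None] padding the
   sets with fewer than [d] elements. *)
pose I : finType := (C * {ffun 'I_d -> option (T * bool)})%type.
have cardI : #|{: I}| = #|C| * (2 * (#|B| + #|C| * #|J|) + 1) ^ d.
  rewrite card_prod card_ffun card_ord card_option card_prod card_sum card_prod card_bool.
  by rewrite addn1 mulnC mulnC [2 * _]mulnC.
pose Sf (f : {ffun 'I_d -> option (T * bool)}) : {set T} :=
  [set x | [exists i, [exists b, f i == Some (x, b)]]].
pose sf (f : {ffun 'I_d -> option (T * bool)}) : {set T} :=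
  [set x | [exists i, f i == Some (x, true)]].
have Sfd f : #|Sf f| <= d.
  have SI : injective (@Some T) by move=> x y [].
  rewrite -(card_imset _ SI) -[leqRHS](card_ord d) -cardsT.
  apply: leq_trans (leq_imset_card (fun i => omap fst (f i)) _); apply: subset_leq_card.
  apply/subsetP => _ /imsetP[x + ->]; rewrite inE => /existsP[i /existsP[b /eqP fi]].
  by apply/imsetP; exists i; rewrite ?inE // fi.
pose pos (c : C) (j : J) : T := inr (c, j).
have posI c : injective (pos c) by move=> j j' [].
pose bad (q : I) : {set {ffun T * T -> bool}} := [set w | [forall j, pos q.1 j \notin Sf q.2] &&
  [forall j, [exists x in Sf q.2, tournament_of w (pos q.1 j) x != (x \in sf q.2)]]].
(* Fewer than [d] prescriptions are easier to meet: [1 - 2^-a <= 1 - 2^-d] for [a <= d]. *)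
have badle q : #|bad q| * (2 ^ d) ^ #|J| <= #|{: {ffun T * T -> bool}}| * (2 ^ d - 1) ^ #|J|.
  have [/forallP ok|no] := boolP [forall j, pos q.1 j \notin Sf q.2]; last first.
    by rewrite (_ : bad q = set0) ?cards0 //; apply/setP => w; rewrite !inE (negPf no).
  have := card_bad_choices (sf q.2) (posI q.1) ok; move: (Sfd q.2).
  have -> : [set w | [forall j, [exists x in Sf q.2, tournament_of w (pos q.1 j) x != (x \in sf q.2)]]]
      = bad q by apply/setP => w; rewrite !inE; have /forallP -> := ok.
  move: #|bad q| #|Sf q.2| => b a ad E; rewrite -(subnK ad) expnD expnMn mulnCA E mulnCA.
  rewrite leq_mul2l -expnMn; apply/orP; right.
  have le : 2 ^ (d - a) * (2 ^ a - 1) <= 2 ^ (d - a) * 2 ^ a - 1.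
    by rewrite mulnBr muln1; apply: leq_sub2l; rewrite expn_gt0.
  by case: #|J| => // m; rewrite leq_exp2r.
have [w wgood] : exists w, forall q, w \notin bad q.
  apply/not_existsP => H; have {}H w : exists q, w \in bad q.
    by apply: contrapT => no; apply: (H w) => q; apply/negP => wq; apply: no; exists q.
  have le : #|{: {ffun T * T -> bool}}| <= \sum_q #|bad q|.
    rewrite -sum1_card; under [leqRHS]eq_bigr do rewrite -sum1_card.
    rewrite (exchange_big_dep predT) //=; apply: leq_sum => w _.
    by have [q wq] := H w; rewrite (bigD1 q).
  have : #|{: {ffun T * T -> bool}}| * (2 ^ d) ^ #|J| <=
      #|{: {ffun T * T -> bool}}| * (#|{: I}| * (2 ^ d - 1) ^ #|J|).
    apply: (@leq_trans (\sum_q #|bad q| * (2 ^ d) ^ #|J|)); first by rewrite -big_distrl leq_mul2r le orbT.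
    rewrite mulnCA -sum_nat_const; exact: leq_sum.
  rewrite leq_mul2l leqNgt cardI lt orbF => /eqP E.
  by have := card_ffun {: T * T} bool; rewrite E card_bool => /esym/eqP; rewrite expn_eq0.
exists (tournament_of w); split; first exact: tournament_ofP.
move=> c S s Sd cS; pose l := [seq Some (x, x \in s) | x <- enum S].
have szl : size l = #|S| by rewrite size_map -cardE.
pose f := [ffun i : 'I_d => nth None l i].
have fP x b : (exists i, f i = Some (x, b)) <-> x \in S /\ b = (x \in s).
  split=> [[i]|[xS ->]].
    rewrite ffunE => E; have : Some (x, b) \in l.
      rewrite -E; apply: mem_nth; rewrite ltnNge; apply/negP => le.
      by rewrite nth_default in E.
    by move=> /mapP[y]; rewrite mem_enum => yS [-> ->].
  have lt' : index x (enum S) < size (enum S) by rewrite index_mem mem_enum.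
  have ltd : index x (enum S) < d by apply: leq_trans lt' _; rewrite -cardE.
  exists (Ordinal ltd); rewrite ffunE (nth_map x) //= nth_index ?mem_enum //.
have SfE : Sf f = S.
  apply/setP => x; rewrite inE; apply/existsP/idP => [[i /existsP[b /eqP fi]]|xS].
    by have [|] := (fP x b).1; [exists i|].
  by have [|i fi] := (fP x (x \in s)).2; [|exists i; apply/existsP; exists (x \in s); rewrite fi].
have sfE x : x \in S -> (x \in sf f) = (x \in s).
  move=> xS; rewrite inE; apply/existsP/idP => [[i /eqP fi]|xs].
    by have [|_ <-] := (fP x true).1; [exists i|].
  by have [|i fi] := (fP x true).2; [|exists i; rewrite fi].
have := wgood (c, f); rewrite inE SfE negb_and => /orP[/forallPn[j]|/forallPn[j /exists_inPn H]].
  by rewrite negbK => jS; have := cS j; rewrite jS.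
by exists j => x xS; have := H x xS; rewrite negbK sfE // => /eqP.
Qed.

Lemma injection_of_leq (V B : finType) (V1 : {set V}) : 0 < #|V1| <= #|B| ->
  exists f : V -> B, {in V1 &, injective f}.
Proof.
case/andP=> V1gt le; have [b _] : exists b, b \in B by apply/card_gt0P; exact: leq_trans le.
exists (fun v => nth b (enum B) (index v (enum V1))) => u v uV vV /eqP.
have lt w : w \in V1 -> index w (enum V1) < size (enum B).
  by move=> wV; rewrite -cardE; apply: leq_trans le; rewrite [#|V1|]cardE index_mem mem_enum.
rewrite nth_uniq ?enum_uniq ?lt // => /eqP /(congr1 (nth u (enum V1))).
by rewrite !nth_index ?mem_enum.
Qed.

(* The vertices of a small core get their own colors; the others are added one by
   one in an order in which each has at most [d] neighbors before it. *)
Lemma greedy_coloring (V B C J : finType) (e : rel V) (D : {set V * V})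
    (psi : {ffun V -> C}) (tau : rel (B + C * J)) (x0 : B + C * J) (d : nat) :
    orientation e D -> dipath2_coloring D psi -> tournament tau ->
    (forall c (S s : {set B + C * J}), #|S| <= d -> (forall j, inr (c, j) \notin S) ->
      exists j, forall x, x \in S -> tau (inr (c, j)) x = (x \in s)) ->
    (forall V1 : {set V}, #|B| < #|V1| ->
      exists2 v, v \in V1 & #|[set u in V1 | e v u]| <= d) ->
  exists phi : {ffun V -> B + C * J}, oriented_coloring D phi.
Proof.
move=> /andP[/forallP Dor /forallP eD] /andP[/forallP psi1 /forallP psi2] [tirr tasym] univ deg.
have Dasym u v : (u, v) \in D -> (v, u) \in D -> False.
  by move=> uv vu; have /forallP/(_ v) := Dor u; rewrite uv vu.
have psiD u v : (u, v) \in D -> psi u != psi v by have /forallP/(_ v)/implyP := psi1 u.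
have psiDD u v w : (u, v) \in D -> (v, w) \in D -> psi u != psi w.
  by move=> uv vw; have /forallP/(_ v)/forallP/(_ w) := psi2 u; rewrite uv vw.
have eE u v : e u v = ((u, v) \in D) || ((v, u) \in D) by have /forallP/(_ v)/eqP := eD u.
pose core (x : B + C * J) := if x is inl _ then true else false.
(* Arcs inside the core need not follow [tau]: core colors are never repeated. *)
pose good (V1 : {set V}) (phi : V -> B + C * J) :=
  [/\ forall u c j, u \in V1 -> phi u = inr (c, j) -> c = psi u,
      forall u v, u \in V1 -> v \in V1 -> core (phi u) -> phi u = phi v -> u = v &
      forall u v, u \in V1 -> v \in V1 -> (u, v) \in D -> ~~ (core (phi u) && core (phi v)) ->
        tau (phi u) (phi v)].
have main (V1 : {set V}) : exists phi, good V1 phi.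
  have [n] := ubnP #|V1|; elim: n V1 => // n IH V1 V1n.
  have [le|gt] := leqP #|V1| #|B|.
    have [V0|V0] := posnP #|V1|.
      by exists (fun=> x0); rewrite (cards0_eq V0); split=> u *; have := in_set0 u; congruence.
    have [f fI] := injection_of_leq (introT andP (conj V0 le)).
    by exists (fun v => inl (f v)); split=> // u v uV vV _ [/fI]; exact.
  have [v vV vdeg] := deg _ gt.
  have [|phi [g1 g2 g3]] := IH (V1 :\ v); first by have := cardsD1 v V1; rewrite vV; lia.
  pose nb := [set u in V1 | e v u]; pose S := phi @: nb.
  pose s := [set phi u | u in [set u in V1 | (v, u) \in D]].
  have nbV u : u \in nb -> u \in V1 :\ v.
    rewrite !inE => /andP[-> evu]; rewrite andbT; apply: contraTneq evu => ->.
    by rewrite eE; apply/negP => /orP[] vv; exact: (Dasym v v).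
  have nS j : inr (psi v, j) \notin S.
    apply/negP => /imsetP[u unb /esym /(g1 _ _ _ (nbV _ unb)) E].
    by move: unb; rewrite inE eE => /andP[_ /orP[]] /psiD; rewrite E eqxx.
  have [j jP] := univ (psi v) S s (leq_trans (leq_imset_card _ _) vdeg) nS.
  pose phi' u := if u == v then inr (psi v, j) else phi u.
  have phi'E u : u \in V1 -> u != v -> phi' u = phi u /\ u \in V1 :\ v.
    by move=> uV uv; rewrite /phi' (negPf uv) !inE uv.
  have phi'v : phi' v = inr (psi v, j) by rewrite /phi' eqxx.
  have outs u : u \in V1 -> (v, u) \in D -> tau (phi' v) (phi u).
    move=> uV vu; have unb : u \in nb by rewrite inE uV eE vu.
    have pS : phi u \in S by exact: imset_f.
    by rewrite phi'v (jP _ pS); apply: imset_f; rewrite inE uV.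
  (* An in-neighbor and an out-neighbor of [v] with a common color would be equal if the color is in
     the core, and otherwise would have the same [psi]-color at the ends of a directed 2-path. *)
  have ins u : u \in V1 -> (u, v) \in D -> ~~ tau (phi' v) (phi u).
    move=> uV uv; have unb : u \in nb by rewrite inE uV eE uv orbT.
    have pS : phi u \in S by exact: imset_f.
    rewrite phi'v (jP _ pS); apply/negP => /imsetP[w]; rewrite inE => /andP[wV vw] E.
    have wnb : w \in nb by rewrite inE wV eE vw.
    case E' : (phi u) => [b|[c i]].
      have uw := g2 u w (nbV _ unb) (nbV _ wnb); rewrite E' /= in uw; rewrite -E E' in uw.
      by apply: (Dasym u v) => //; rewrite {1}(uw isT erefl).
    have := psiDD _ _ _ uv vw; rewrite -(g1 u _ _ (nbV _ unb) E').
    by rewrite -(g1 w c i (nbV _ wnb)) ?eqxx // -E.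
  exists phi'; split.
  - move=> u c i uV; have [->|uv] := eqVneq u v; first by rewrite phi'v => -[].
    by have [-> uV'] := phi'E u uV uv; exact: g1.
  - move=> u w uV wV; have [->|uv] := eqVneq u v; first by rewrite phi'v.
    have [-> uV'] := phi'E u uV uv.
    have [->|wv] := eqVneq w v; first by rewrite phi'v => + E; rewrite E.
    by have [-> wV'] := phi'E w wV wv; exact: g2.
  - move=> u w uV wV; have [->|uv] := eqVneq u v.
      move=> vw _; have wv : w != v.
        by apply: contraTneq vw => ->; apply/negP => vv; exact: (Dasym v v).
      by have [-> wV'] := phi'E w wV wv; exact: outs.
    have [-> uV'] := phi'E u uV uv.
    have [->|wv] := eqVneq w v.
      move=> uvD _; rewrite tasym ?ins //; have := nS j; rewrite -phi'v; apply: contraNneq => <-.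
      by apply: imset_f; rewrite inE uV eE uvD orbT.
    by have [-> wV'] := phi'E w wV wv; exact: g3.
have [phi [_ g2 g3]] := main [set: V].
exists [ffun u => phi u].
have ne u v : (u, v) \in D -> phi u != phi v.
  move=> uv; apply/eqP => E; have [cu|ncu] := boolP (core (phi u)).
    by have uv' := g2 u v (in_setT _) (in_setT _) cu E; move: uv; rewrite uv' => vv; exact: (Dasym v v).
  by have := g3 u v (in_setT _) (in_setT _) uv; rewrite E andbb -E => /(_ ncu); rewrite (negPf (tirr _)).
apply/andP; split.
  by apply/forallP => u; apply/forallP => v; apply/implyP => /ne; rewrite !ffunE.
apply/forallP => u; apply/forallP => v; apply/forallP => u'; apply/forallP => v'.
apply/implyP => /andP[uv v'u']; rewrite !ffunE xpair_eqE; apply/negP => /andP[/eqP eu /eqP ev].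
have [/andP[cu cv]|nc] := boolP (core (phi u) && core (phi v)).
  have uE := g2 u u' (in_setT _) (in_setT _) cu eu; have vE := g2 v v' (in_setT _) (in_setT _) cv ev.
  by apply: (Dasym u v) => //; rewrite uE vE.
have t1 := g3 _ _ (in_setT u) (in_setT v) uv nc.
have nc' : ~~ (core (phi v') && core (phi u')) by rewrite -eu -ev andbC.
have t2 := g3 _ _ (in_setT v') (in_setT u') v'u' nc'.
by move: t1; rewrite tasym ?ne // eu ev t2.
Qed.

(** * The bound *)

Lemma oriented_coloring_inj (V C C' : finType) (D : {set V * V}) (phi : {ffun V -> C})
    (f : C -> C') : injective f ->
  oriented_coloring D phi -> oriented_coloring D [ffun v => f (phi v)].
Proof.
move=> fI /andP[/forallP H1 /forallP H2]; apply/andP; split.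
  apply/forallP => u; apply/forallP => v; rewrite !ffunE (inj_eq fI).
  by have /forallP := H1 u; apply.
apply/forallP => u; apply/forallP => v; apply/forallP => u'; apply/forallP => v'.
rewrite !ffunE xpair_eqE !(inj_eq fI) -xpair_eqE.
by have /forallP/(_ v)/forallP/(_ u')/forallP/(_ v') := H2 u.
Qed.

Lemma dipath2_colorableW (V : finType) (D : {set V * V}) k k' : k <= k' ->
  dipath2_colorable D k -> exists phi : {ffun V -> 'I_k'}, dipath2_coloring D phi.
Proof.
move=> kk' /existsP[phi /andP[/forallP H1 /forallP H2]].
have wI : injective (widen_ord kk') by move=> x y /(congr1 val) /= E; exact: val_inj.
exists [ffun v => widen_ord kk' (phi v)]; apply/andP; split.
  apply/forallP => u; apply/forallP => v; rewrite !ffunE (inj_eq wI).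
  by have /forallP := H1 u; apply.
apply/forallP => u; apply/forallP => v; apply/forallP => w; rewrite !ffunE (inj_eq wI).
by have /forallP/(_ v)/forallP/(_ w) := H2 u.
Qed.

Lemma chi_o_le (R : realType) (V : finType) (e : rel V) (g m : nat) :
    symmetric e -> irreflexive e -> is_euler_genus R e g ->
    chi_2 e * (2 * (6 * g + chi_2 e * m) + 1) ^ 6 * (2 ^ 6 - 1) ^ m < (2 ^ 6) ^ m ->
  chi_o e <= 6 * g + chi_2 e * m.
Proof.
move=> esym eirr eg lt; set k := chi_2 e in lt *; apply/bigmax_leqP => D oD.
have Dor : oriented D by case/andP: oD.
have [V0|/card_gt0P[v0 _]] := posnP #|V|.
  by apply: (@leq_trans 0) => //; rewrite -V0 -ltnS; exact: ltn_ord.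
have [/dipath2_colorableW col2 _] := chi_2_digraphP Dor.
have [psi psiP] : exists phi : {ffun V -> 'I_k}, dipath2_coloring D phi.
  by apply: col2; apply: (leq_bigmax_cond (F := @chi_2_digraph V)).
have [|tau [tauT univ]] := @universal_tournament 'I_(6 * g) 'I_k 'I_m 6.
  by rewrite !card_ord.
(* The empty prescription already provides a color, which serves as the default value for
   [greedy_coloring]. *)
have [j _] : exists j : 'I_m, forall x, x \in set0 -> tau (inr (psi v0, j)) x = (x \in set0).
  by apply: univ => [|j]; rewrite ?cards0 ?inE.
have [|phi phiP] := greedy_coloring (inr (psi v0, j)) oD psiP tauT univ.
  by move=> V1; rewrite card_ord; exact: (genus_low_degree esym eirr eg).
have [_ chi_min] := chi_o_digraphP Dor; apply: chi_min.
have cardT : #|{: 'I_(6 * g) + 'I_k * 'I_m}| = 6 * g + k * m.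
  by rewrite card_sum card_prod !card_ord.
apply/existsP; rewrite -cardT; exists [ffun v => enum_rank (phi v)].
exact: oriented_coloring_inj enum_rank_inj phiP.
Qed.

(** * Size of the palette *)

(** Bernoulli's inequality [(1 + 1/n)^j >= 1 + j/n] without denominators; [j = n] gives the doubling
    that makes [(63/64)^63] at most [1/2]. *)
Lemma bernoulli_exp n j : n ^ j * (n + j) <= n.+1 ^ j * n.
Proof.
elim: j => [|j IH]; first by rewrite addn0.
rewrite [in leqRHS]expnS -mulnA; apply: leq_trans (leq_mul (leqnn _) IH).
by rewrite expnS -mulnA mulnCA [leqRHS]mulnCA leq_mul2l; apply/orP; right; nia.
Qed.

Lemma double_exp n : 0 < n -> 2 * n ^ n <= n.+1 ^ n.
Proof.
move=> n0; have := bernoulli_exp n n; rewrite addnn -mul2n mulnA leq_pmul2r //.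
by rewrite mulnC.
Qed.

(** By doubling, the ratio of the two powers is at least [2^(128 l)], while the number of
    constraints is at most [2^l * 2^(6 (15 + 2 l)) = 2^(90 + 13 l)], which is smaller as soon as
    [l >= 1]. *)
Lemma target_size_aux n k g l : 0 < n <= 63 -> k + g + 2 <= 2 ^ l ->
  k * (2 * (6 * g + k * (n * 2 ^ 7 * l)) + 1) ^ 6 * n ^ (n * 2 ^ 7 * l)
    < n.+1 ^ (n * 2 ^ 7 * l).
Proof.
move=> /andP[n0 n63] le; have l0 : 0 < l by case: l le => //; rewrite expn0; lia.
have lX : l <= 2 ^ l by apply: ltnW; exact: ltn_expl.
have pow : 2 ^ (2 ^ 7 * l) * n ^ (n * 2 ^ 7 * l) <= n.+1 ^ (n * 2 ^ 7 * l).
  rewrite -mulnA !(expnM _ n) -expnMn leq_exp2r ?muln_gt0 ?expn_gt0 //.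
  exact: double_exp.
apply: leq_trans pow; rewrite ltn_pmul2r ?expn_gt0 ?n0 //.
have kX : k <= 2 ^ l by apply: leq_trans le; lia.
have gX : g + 1 <= 2 ^ l by apply: leq_trans le; lia.
have t : 2 * (6 * g + k * (n * 2 ^ 7 * l)) + 1 <= 2 ^ (8 + 7 + (l + l)).
  rewrite (expnD 2 (8 + 7)) (expnD 2 8) (expnD 2 l) -[2 ^ 8]/256 -[2 ^ 7]/128 -mulnA.
  have := leq_mul kX lX; have : 2 ^ l <= 2 ^ l * 2 ^ l by rewrite leq_pmulr // expn_gt0.
  rewrite (_ : k * (n * (128 * l)) = 128 * (n * (k * l))); last by nia.
  have : n * (k * l) <= 63 * (k * l) by rewrite leq_mul2r n63 orbT.
  move: (n * (k * l)) gX; move: (k * l) (2 ^ l * 2 ^ l) (2 ^ l) => a b c d; clear; lia.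
apply: leq_ltn_trans (leq_mul kX (_ : _ <= (2 ^ (8 + 7 + (l + l))) ^ 6)) _.
  by rewrite leq_exp2r.
by rewrite -expnM -expnD ltn_exp2l //; clear -l0; lia.
Qed.

Lemma target_size k g l : k + g + 2 <= 2 ^ l ->
  k * (2 * (6 * g + k * (63 * 2 ^ 7 * l)) + 1) ^ 6 * (2 ^ 6 - 1) ^ (63 * 2 ^ 7 * l)
    < (2 ^ 6) ^ (63 * 2 ^ 7 * l).
Proof.
move=> /(@target_size_aux 63 _ _ _ isT).
have -> : 2 ^ 6 - 1 = 63 by [].
by have -> : 2 ^ 6 = 63.+1 by [].
Qed.

Lemma sqr_le_exp l : l ^ 2 <= 2 * 2 ^ l.
Proof.
elim: l => // l IH; have := ltn_expl l (isT : 1 < 2); rewrite [2 ^ l.+1]expnS.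
by move: IH; rewrite -!mulnn; move: (2 ^ l) => x; clear; nia.
Qed.

Local Open Scope ring_scope.

(** Here [log (k + g)] turns into [log k]. If [k^2 < g + 2], then [k l <= k^2 + l^2] is linear in
    [g], since [l^2 <= 2 * 2^l]. Otherwise [k >= 2] and [2^l <= 4 k^2 <= k^4], so [l] is at most
    [4 ln k / ln 2]. *)
Lemma mul_up_log_le (R : realType) (k g : nat) :
  ((k * up_log 2 (k + g + 2))%N%:R : R)
    <= 4 / ln 2 * (k%:R * ln k%:R) + 18 * (g%:R + 1).
Proof.
set l := up_log 2 _.
have ln2 : 0 < ln 2 :> R by rewrite ln_gt0 // ltr1n.
have kln : 0 <= k%:R * ln k%:R :> R.
  by case: k @l => [|k] l; rewrite ?mul0r // mulr_ge0 // ln_ge0 // ler1n.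
have l1 : (1 < k + g + 2)%N by rewrite addn2.
have l0 : (0 < l)%N by rewrite up_log_gt0 l1.
have lt : (2 ^ l < 2 * (k + g + 2))%N.
  by have := up_log_gtn (isT : (1 < 2)%N) l1; rewrite -/l -[in (2 ^ l)%N](prednK l0) expnS ltn_pmul2l.
have [k2|k2] := ltnP (k ^ 2)%N (g + 2).
  have kl : (k * l <= 18 * (g + 1))%N.
    have := sqr_le_exp l; have kk : (k <= k ^ 2)%N by rewrite -mulnn; nia.
    have : (k * l <= k ^ 2 + l ^ 2)%N by rewrite -!mulnn; nia.
    by move: kk k2 lt; move: (k * l)%N (k ^ 2)%N (l ^ 2)%N (2 ^ l)%N => a b c d; clear; lia.
  apply: (@le_trans _ _ (18 * (g%:R + 1))); last by rewrite lerDr mulr_ge0 // divr_ge0 // ltW.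
  by rewrite natr1 -natrM ler_nat -(addn1 g).
have k0 : (1 < k)%N.
  by rewrite ltnNge; apply: contraTN k2 => k1; rewrite -ltnNge -mulnn; nia.
have le2 : (2 ^ l <= (k * k) ^ 2)%N.
  apply: leq_trans (ltnW lt) _; move: k2; rewrite -!mulnn => k2.
  by apply: (@leq_trans (2 * (2 * (k * k)))); nia.
have lnle : l%:R * ln 2 <= 4 * ln k%:R :> R.
  have kR : 0 < k%:R :> R by rewrite ltr0n ltnW.
  rewrite !mulr_natl -!lnXn // ?ler_ln ?posrE ?exprn_gt0 //.
  by rewrite -!natrX ler_nat; apply: leq_trans le2 _; rewrite mulnn -expnM.
rewrite natrM; apply: (@le_trans _ _ (4 / ln 2 * (k%:R * ln k%:R))); last first.
  by rewrite lerDl mulr_ge0 // addr_ge0.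
rewrite mulrCA ler_wpM2l //.
by rewrite mulrAC ler_pdivlMr.
Qed.

Theorem theorem5p3 (R : realType) :
  exists C : R, forall (V : finType) (e : rel V) (g k : nat),
    symmetric e -> irreflexive e ->
    is_euler_genus R e g -> chi_2 e = k ->
    (chi_o e)%:R < C * (k%:R * ln k%:R + g%:R + 1).
Proof.
pose a : R := (63 * 2 ^ 7)%N%:R; have a0 : 0 <= a by exact: ler0n.
have ln2 : 0 < ln 2 :> R by rewrite ln_gt0 // ltr1n.
(* [7] instead of the [6] of the core makes the inequality strict; the other terms are the constants
   of [mul_up_log_le] times [a]. *)
exists (7 + a * (4 / ln 2) + a * 18) => V e g k esym eirr eg <-.
set l := up_log 2 (chi_2 e + g + 2).
have le := chi_o_le esym eirr eg (target_size (up_logP _ (isT : (1 < 2)%N) : (_ <= 2 ^ l)%N)).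
have kl := mul_up_log_le R (chi_2 e) g; rewrite -/l in kl.
set y := _ * ln _ in kl *.
have y0 : 0 <= y.
  by rewrite /y; case: (chi_2 e) => [|k']; rewrite ?mul0r // mulr_ge0 // ln_ge0 // ler1n.
have {}le : (chi_o e)%:R <= 6 * g%:R + a * (chi_2 e * l)%N%:R :> R.
  rewrite /a -!natrM -natrD ler_nat; apply: leq_trans le _.
  by rewrite leq_add2l mulnCA.
have g0 : 0 <= g%:R :> R by exact: ler0n.
apply: le_lt_trans le _.
have := ler_wpM2l a0 kl; set b := 4 / ln 2.
have b0 : 0 <= b by rewrite divr_ge0 // ltW.
have : 0 <= a * b * (g%:R + 1) by apply: mulr_ge0; [exact: mulr_ge0|exact: addr_ge0].
have : 0 <= a * y by rewrite mulr_ge0.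
move: (_ * _)%N%:R y0 g0; clearbody a b y; move: g%:R => x z y0 x0 h1 h2 h3.
have -> : (7 + a * b + a * 18) * (y + x + 1) =
  a * (b * y + 18 * (x + 1)) + a * b * (x + 1) + 18 * (a * y) + 7 * (y + x + 1) by ring.
by lra.
Qed.
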